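(* Let $(X,T)$ be an essentially minimal Cantor system, $\rho\le 1$ a compatible complete metric on $X$, and $n\ge 1$. The following are equivalent: (1) $(X,T)$ has topological rank $\le n$. (2) There exists $x\in X$ such that for all $\epsilon>0$ there is a Kakutani--Rohlin partition $\mathcal{P}$ with no more than $n$ many towers such that $\mathrm{diam}(A)<\epsilon$ for all $A\in\mathcal{P}$, $\mathrm{diam}(B(\mathcal{P}))<\epsilon$, and $x\in B(\mathcal{P})$. (3) For any clopen subset $Z$ of $X$ with the finite covering property and any finite partition $\mathcal{Q}$ of $X$ into clopen sets, there is a Kakutani--Rohlin partition $\mathcal{P}$ with no more than $n$ many towers such that $B(\mathcal{P})\subseteq Z$, $\mathrm{diam}(B(\mathcal{P}))\le \mathrm{diam}(Z)/2$, and $\mathcal{P}$ refines $\mathcal{Q}$.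
   Context: A Cantor system $(X,T)$ is a homeomorphism $T$ of a Cantor space $X$ (zero-dimensional, perfect, compact metrizable). It is essentially minimal if it has a unique minimal set (nonempty closed set $Y$ with $TY=Y$, minimal among such sets). Systems $(X,T)$ and $(Y,S)$ are conjugate if there is a homeomorphism $\varphi:X\to Y$ with $\varphi T=S\varphi$. Diameters are with respect to $\rho$. A subset $A\subseteq X$ has the finite covering property if $\bigcup_{-N\le m\le N}T^mA=X$ for some $N\in\mathbb{N}$. A Kakutani--Rohlin partition for $(X,T)$ is a partition $\mathcal{P}=\{T^jB(k): 1\le k\le d,\ 0\le j<h(k)\}$ of $X$ into clopen sets, where $d,h(1),\dots,h(d)$ are positive integers and $B(1),\dots,B(d)$ are clopen with $\bigcup_{k=1}^dT^{h(k)}B(k)=\bigcup_{k=1}^dB(k)$; its base is $B(\mathcal{P})=\bigcup_{k=1}^dB(k)$, and it has $d$ towers, the $k$-th being $\{T^jB(k):0\le j<h(k)\}$. $\mathcal{P}$ refines $\mathcal{Q}$ if every element of $\mathcal{Q}$ is a union of elements of $\mathcal{P}$. Topological rank: A Bratteli diagram $(V,E)$ consists of vertices $V=V_0\sqcup V_1\sqcup\cdots$ and edges $E=E_1\sqcup E_2\sqcup\cdots$, all $V_n,E_n$ finite nonempty, $V_0=\{v_0\}$, with maps $\mathsf{s},\mathsf{r}:E\to V$ satisfying $\mathsf{s}(E_n)=V_{n-1}$ and $\mathsf{r}(E_n)=V_n$ for $n\ge1$ (so every vertex is a source, and every vertex other than $v_0$ is a range). It is ordered if it carries a partial order $\preceq$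 on $E$ in which $e,e'$ are comparable iff $\mathsf{r}(e)=\mathsf{r}(e')$. Let $X_B=\{(e_n)_{n\ge1}: e_n\in E_n,\ \mathsf{r}(e_n)=\mathsf{s}(e_{n+1})\}$ with the subspace topology of $\prod_n E_n$. The ordered diagram $B$ is essentially simple if there is a unique $x_{\max}\in X_B$ all of whose edges are $\preceq$-maximal and a unique $x_{\min}\in X_B$ all of whose edges are $\preceq$-minimal. Then the Vershik map $\lambda_B$ sends $x_{\max}$ to $x_{\min}$, and sends $(e_1,e_2,\dots)\ne x_{\max}$ to $(f_1,\dots,f_k,e_{k+1},\dots)$, where $k$ is least with $e_k$ not maximal, $f_k$ is the $\preceq$-successor of $e_k$, and $(f_1,\dots,f_{k-1})$ is the unique path of minimal edges from $v_0$ to $\mathsf{s}(f_k)$. An essentially minimal Cantor system has finite topological rank if it is conjugate to some $(X_B,\lambda_B)$ with $B$ essentially simple and $(|V_n|)_{n\ge1}$ bounded by some natural number $d$; the least possible $d$ is its topological rank. *)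

(* Defs.v *)
From mathcomp Require Import all_boot all_order all_algebra.
From mathcomp Require Import all_classical all_reals all_analysis.

Set Implicit Arguments.
Unset Strict Implicit.
Unset Printing Implicit Defensive.

Import Order.TTheory GRing.Theory Num.Theory.

Local Open Scope classical_set_scope.
Local Open Scope ring_scope.

(** * Systems *)

Definition homeomorphism (X Y : topologicalType) (f : X -> Y) : Prop :=
  continuous f /\
  exists g : Y -> X, [/\ continuous g, cancel f g & cancel g f].

Definition conjugate (X Y : topologicalType) (T : X -> X) (S : Y -> Y) : Prop :=
  exists2 phi : X -> Y, homeomorphism phi & phi \o T = S \o phi.

Section Systems.
Context (X : topologicalType) (T : X -> X).

Definition closed_invariant (Y : set X) : Prop :=
  [/\ Y !=set0, closed Y & T @` Y = Y].

Definition minimal_set (Y : set X) : Prop :=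
  closed_invariant Y /\
  forall Z : set X, closed_invariant Z -> Z `<=` Y -> Z = Y.

Definition essentially_minimal : Prop := exists! Y : set X, minimal_set Y.

(* [T^m A] for [m] an integer; for [m < 0] the image under [T^m] of the
   bijection [T] is the preimage under [T^-m]. *)
Definition zimage (m : int) (A : set X) : set X :=
  match m with
  | Posz k => iter k T @` A
  | Negz k => iter k.+1 T @^-1` A
  end.

Definition finite_covering (A : set X) : Prop :=
  exists N : nat,
    \bigcup_(m in [set m : int | - N%:Z <= m <= N%:Z]) zimage m A = setT.

End Systems.

(** * Kakutani-Rohlin partitions *)

Record towers (X : Type) := Towers {
  ntowers : nat;
  tower_height : 'I_ntowers -> nat;
  tower_base : 'I_ntowers -> set X
}.

Section KakutaniRohlin.
Context (X : topologicalType) (T : X -> X).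

Definition level_index (P : towers X) : set ('I_(ntowers P) * nat) :=
  [set i | (i.2 < tower_height i.1)%N].

Definition level (P : towers X) (i : 'I_(ntowers P) * nat) : set X :=
  iter i.2 T @` tower_base i.1.

Definition base (P : towers X) : set X := \bigcup_k @tower_base X P k.

Definition elements (P : towers X) : set (set X) :=
  @level P @` @level_index P.

Definition kakutani_rohlin (P : towers X) : Prop :=
  [/\ (0 < ntowers P)%N,
      forall k : 'I_(ntowers P), (0 < tower_height k)%N /\ clopen (tower_base k),
      partition (@level_index P) (@level P) setT,
      forall A, elements P A -> clopen A &
      \bigcup_k (iter (@tower_height X P k) T @` tower_base k) = base P].

Definition clopen_finite_partition (Q : set (set X)) : Prop :=
  [/\ finite_set Q, partition Q id setT & forall A, Q A -> clopen A].

Definition refines (P Q : set (set X)) : Prop :=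
  forall A, Q A -> exists2 S : set (set X), S `<=` P & A = \bigcup_(C in S) C.

End KakutaniRohlin.

(* The real [sup] is [0] on the empty set and on unbounded sets: [diam] is the
   usual diameter (with [diam set0 = 0]) when the metric is bounded. *)
Definition diam (R : realType) (X : metricType R) (A : set X) : R :=
  sup [set mdist xy.1 xy.2 | xy in A `*` A].

(** * Ordered Bratteli diagrams *)

(* [vert n] is V_n and [edge n] is E_(n+1). Edges with the same range lie in
   the same E_n, so the order on E is a family of orders on the E_n. *)
Record ordered_bratteli := OrderedBratteli {
  vert : nat -> finType;
  edge : nat -> finType;
  src : forall n, edge n -> vert n;
  rng : forall n, edge n -> vert n.+1;
  ele : forall n, rel (edge n);
  vert_gt0 : forall n, (0 < #|vert n|)%N;
  edge_gt0 : forall n, (0 < #|edge n|)%N;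
  card_vert0 : #|vert 0| = 1%N;
  src_surj : forall n (v : vert n), exists e : edge n, src e = v;
  rng_surj : forall n (v : vert n.+1), exists e : edge n, rng e = v;
  ele_refl : forall n, reflexive (@ele n);
  ele_anti : forall n, antisymmetric (@ele n);
  ele_trans : forall n, transitive (@ele n);
  ele_comparable : forall n (e f : edge n),
    (ele e f \/ ele f e) <-> rng e = rng f
}.

Arguments src B {n} : rename.
Arguments rng B {n} : rename.
Arguments ele B {n} : rename.

Section Bratteli.
Context (B : ordered_bratteli).

Definition max_edge n (e : edge B n) : Prop :=
  forall f : edge B n, ele B e f -> f = e.

Definition min_edge n (e : edge B n) : Prop :=
  forall f : edge B n, ele B f e -> f = e.

Definition succ_edge n (e f : edge B n) : Prop :=
  [/\ ele B e f, f <> e &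
      forall g : edge B n, ele B e g -> ele B g f -> g = e \/ g = f].

Definition edge_sequences : topologicalType :=
  prod_topology (fun n => discrete_topology (edge B n)).

Definition infinite_paths : set edge_sequences :=
  [set x : forall n, edge B n | forall n, rng B (x n) = src B (x n.+1)].

(* X_B; subtypes carry the initial topology for the inclusion. *)
Definition path_space : topologicalType := set_type infinite_paths.

Definition path_edge (x : path_space) (n : nat) : edge B n := set_val x n.

Definition max_path (x : path_space) : Prop :=
  forall n, max_edge (path_edge x n).

Definition min_path (x : path_space) : Prop :=
  forall n, min_edge (path_edge x n).

Definition essentially_simple : Prop :=
  (exists! x, max_path x) /\ (exists! x, min_path x).

(* The graph of the Vershik map. That [y] starts with a path of minimal edges
   from the top vertex to the source of its [k]-th edge is the combination of
   [y] being a path and of the minimality clause. *)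
Definition vershik_graph (x y : path_space) : Prop :=
  (max_path x /\ min_path y) \/
  exists k : nat,
    [/\ forall i, (i < k)%N -> max_edge (path_edge x i),
        ~ max_edge (path_edge x k),
        succ_edge (path_edge x k) (path_edge y k),
        forall i, (i < k)%N -> min_edge (path_edge y i) &
        forall i, (k < i)%N -> path_edge y i = path_edge x i].

(* The default value of [xget] is never used when [B] is essentially simple:
   see [vershik_graph_unique_exists]. *)
Definition vershik (x : path_space) : path_space :=
  xget x [set y | vershik_graph x y].

End Bratteli.

(** * Topological rank *)

Definition rank_bound (X : topologicalType) (T : X -> X) (d : nat) : Prop :=
  exists B : ordered_bratteli,
    [/\ essentially_simple B,
        forall m, (1 <= m)%N -> (#|vert B m| <= d)%N &
        conjugate T (@vershik B)].

Definition is_topological_rank (X : topologicalType) (T : X -> X) (d : nat) :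
    Prop :=
  rank_bound T d /\ forall d' : nat, rank_bound T d' -> (d <= d')%N.

Definition topological_rank_le (X : topologicalType) (T : X -> X) (n : nat) :
    Prop :=
  exists2 d : nat, is_topological_rank T d & (d <= n)%N.

(** * The Vershik map is well defined *)

Section VershikWellDefined.
Context (B : ordered_bratteli).

Lemma ex_ele_minimal n (S : set (edge B n)) :
  S !=set0 -> exists2 f, S f & forall g, S g -> ele B g f -> g = f.
Proof.
move=> [e0 Se0].
pose D (f : edge B n) := #|[pred g | ele B g f]|.
have [|f /asboolP Sf fmin] := @arg_minnP _ e0 (fun f => `[< S f >]) D.
  exact/asboolP.
exists f => // g Sg gf.
have := fmin g (asboolT Sg).
have sub : [pred h | ele B h g] \subset [pred h | ele B h f].
  by apply/fintype.subsetP => h; rewrite !inE => hg; apply: ele_trans gf.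
move=> le; have /subset_leqif_card/geq_leqif := sub.
rewrite -/(D f) -/(D g) le => /esym/fintype.subsetP/(_ f).
rewrite !inE ele_refl => /(_ isT) fg.
by apply/ele_anti/andP.
Qed.

Lemma ex_min_edge n (v : vert B n.+1) :
  exists2 e : edge B n, rng B e = v & min_edge e.
Proof.
have [|e ev emin] := @ex_ele_minimal n [set e | rng B e = v].
  by have [e ?] := rng_surj v; exists e.
exists e => // f fe; apply: emin => //=.
by rewrite -ev; apply/ele_comparable; left.
Qed.

Lemma ex_succ_edge n (e : edge B n) :
  ~ max_edge e -> exists f, succ_edge e f.
Proof.
move=> /existsNP[f0 /not_implyP[ef0 f0e]].
have [|f [ef fe] fmin] := @ex_ele_minimal n [set f | ele B e f /\ f <> e].
  by exists f0.
exists f; split=> // g eg gf; have [->|ge] := eqVneq g e; first by left.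
by right; apply: fmin => //; split=> //; exact/eqP.
Qed.

Lemma ex_min_prefix k (x : forall n, edge B n) :
  (forall i, (k <= i)%N -> rng B (x i) = src B (x i.+1)) ->
  exists y : forall n, edge B n,
    [/\ forall i, rng B (y i) = src B (y i.+1),
        forall i, (i < k)%N -> min_edge (y i) &
        forall i, (k <= i)%N -> y i = x i].
Proof.
elim: k x => [|k IH] x xP; first by exists x; split=> // i; exact: xP.
have [e ev emin] := ex_min_edge (src B (x k.+1)).
have [i ki|y [yP ymin yx]] := IH (dfwith x k e).
  have [<-|nk] := eqVneq k i.
    by rewrite dfwithin dfwithout ?ev// neq_ltn ltnSn.
  by rewrite !dfwithout ?xP// 1?ltn_neqAle ?nk// neq_ltn ltnS ki.
exists y; split=> // i.
  rewrite ltnS leq_eqVlt => /predU1P[->|/ymin//].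
  by rewrite yx// dfwithin.
by move=> ki; rewrite yx ?(ltnW ki)// dfwithout// neq_ltn ki.
Qed.

Lemma min_edge_inj n (e f : edge B n) :
  rng B e = rng B f -> min_edge e -> min_edge f -> e = f.
Proof. by move=> /ele_comparable[ef|fe] emin fmin; [exact: fmin|exact/esym/emin]. Qed.

Lemma succ_edge_inj n (e f g : edge B n) :
  succ_edge e f -> succ_edge e g -> f = g.
Proof.
move=> [ef fe fP] [eg ge gP].
have /ele_comparable : rng B f = rng B g.
  rewrite -[RHS](_ : rng B e = _) 1?[LHS](_ : _ = rng B e)//.
    by apply/ele_comparable; right.
  by apply/ele_comparable; left.
by case=> [fg|gf]; [case: (gP f ef fg)|case: (fP g eg gf)].
Qed.

Lemma vershik_graph_unique_exists (x : path_space B) :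
  essentially_simple B -> exists! y, vershik_graph x y.
Proof.
move=> [_ [xmin [minP minU]]].
have [xmax|] := pselect (max_path x).
  exists xmin; split; first by left.
  by move=> y [[_ /minU//]|[k [_ nk _ _ _]]]; case: nk; exact: xmax.
move=> xNmax; have /existsNP[k0 k0P] := xNmax.
have exk : exists k, `[< ~ max_edge (path_edge x k) >].
  by exists k0; exact/asboolP.
have [k /asboolP kN kmin] := ex_minnP exk.
have xmax i : (i < k)%N -> max_edge (path_edge x i).
  move=> ik; apply: contrapT => iN; have := kmin i (asboolT iN).
  by rewrite leqNgt ik.
have [f xf] := ex_succ_edge kN.
have xP i : rng B (path_edge x i) = src B (path_edge x i.+1).
  by have := set_valP x; apply.
have [i ki|y [yP ymin yx]] := @ex_min_prefix k (dfwith (path_edge x) k f).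
  have [<-|nk] := eqVneq k i.
    rewrite dfwithin dfwithout ?neq_ltn ?ltnSn// -xP.
    by case: xf => xf _ _; apply/ele_comparable; right.
  by rewrite !dfwithout ?xP// neq_ltn ltnS ki.
pose y' : path_space B := SigSub (mem_set (yP : infinite_paths y)).
have y'E i : path_edge y' i = y i by [].
exists y'; split.
  right; exists k; split=> //.
    by rewrite y'E yx// dfwithin.
  by move=> i ki; rewrite y'E yx ?(ltnW ki)// dfwithout// neq_ltn ki.
move=> z [[/xNmax//]|[l [lmax lN xz zmin zx]]].
have kl : l = k.
  apply/eqP; rewrite eqn_leq; apply/andP; split; rewrite leqNgt.
    by apply/negP => /lmax.
  by apply/negP => /xmax.
subst l.
have zP i : rng B (path_edge z i) = src B (path_edge z i.+1).
  by have := set_valP z; apply.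
have yk : y k = path_edge z k.
  by rewrite yx// dfwithin; exact: succ_edge_inj xf xz.
have yzlt j : (j <= k)%N -> y (k - j)%N = path_edge z (k - j)%N.
  elim: j => [|j IH] jk; first by rewrite subn0.
  have E : (k - j = (k - j.+1).+1)%N by rewrite subnSK.
  have lt : (k - j.+1 < k)%N by rewrite -E leq_subr.
  apply: min_edge_inj; [|exact: ymin|exact: zmin].
  by rewrite yP zP; move: (IH (ltnW jk)); rewrite E => ->.
apply: val_inj; apply: functional_extensionality_dep => i /=.
have [ik|ki] := leqP i k; first by have := yzlt _ (leq_subr i k); rewrite subKn.
by rewrite [RHS]zx// yx ?(ltnW ki)// dfwithout// neq_ltn ki.
Qed.

Lemma vershikP (x : path_space B) :
  essentially_simple B -> vershik_graph x (vershik x).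
Proof.
move=> /(vershik_graph_unique_exists x)[y [xy _]].
exact: (@xgetI _ x [set y | vershik_graph x y] y).
Qed.

End VershikWellDefined.

(* Main.v *)
Require Import Defs.
From HB Require Import structures.
From mathcomp Require Import all_boot all_order all_algebra.
From mathcomp Require Import all_classical all_reals all_analysis.

Set Implicit Arguments.
Unset Strict Implicit.
Unset Printing Implicit Defensive.

Import Order.TTheory GRing.Theory Num.Theory.

Local Open Scope classical_set_scope.
Local Open Scope ring_scope.

(* (1) => (2): in X_B the paths whose first m edges are minimal form the base of
   a Kakutani-Rohlin partition with one tower per vertex of V_m; its elements
   are the cylinders of length m, and its bases shrink to x_min.
   (2) => (3): if T^m x lies in Z, then the T^m-image of a fine enough partition
   with x in its base is the required one.
   (3) => (1): iterating (3) gives partitions P_0 = {X}, P_1, P_2, ... with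
   nested bases shrinking to a point, each refining the previous one and
   eventually separating points. The vertices of level k are the towers of P_k,
   and the edges into a tower of P_(k+1) are its successive passages through
   towers of P_k, in order of height. *)

(** * Compact metric spaces and path spaces *)

(** For (1) => (2), a minimal prefix of length m is determined by the vertex where it ends, and
    until the whole prefix is maximal the Vershik map changes it in a way that depends on the prefix
    alone. So the return time to the base and the cylinders met on the way are functions of that
    vertex. For (2) => (3), powers of T commute with T, so a translated partition keeps its heights
    and its number of towers. Perfectness gives diam Z > 0, which leaves room for a base of half
    that diameter. For (3) => (1), the metric bound in (3) concerns bases only, so points are
    separated through the choice of Q: step k resolves the k-th of the countably many clopen sets. A
    point is coded by its positions (tower, height) in the P_k; its path stores the towers and the
    increments of the heights, which can be summed because the height in P_0 is 0. If z is the
    common point of the bases, the unique minimal path is that of z and the unique maximal one that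
    of T^-1 z. *)

Lemma clopen_enumeration (R : realType) (X : metricType R) (x0 : X) :
  compact [set: X] ->
  exists U : nat -> set X,
    (forall k, clopen (U k)) /\ forall A, clopen A -> exists k, U k = A.
Proof.
move=> cX.
(* [clopen_surj] is about pointed spaces; [x0] serves as the point. *)
pose PX : pseudoPMetricType R := HB.pack X (isPointed.Build X x0).
have /(@clopen_surj R PX)[f] : compact [set: PX] by [].
exists f; split=> [k|A cA]; first exact: (@funS _ _ _ _ f k).
by have [k _ kA] := @surj _ _ _ _ f A cA; exists k.
Qed.

(** A cluster point of points chosen in the [F k] works: each closed [F k] contains a tail of the
    sequence. *)
Lemma compact_nested (X : topologicalType) (F : nat -> set X) :
  compact [set: X] -> (forall k, closed (F k)) -> (forall k, F k !=set0) ->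
  (forall k, F k.+1 `<=` F k) -> exists x, forall k, F k x.
Proof.
move=> cX cF F0 dF; have [x Fx] := choice F0.
have mF j k : (k <= j)%N -> F j `<=` F k.
  elim: j => [|j IH]; first by rewrite leqn0 => /eqP ->.
  rewrite leq_eqVlt => /predU1P[->//|/IH]; exact: subset_trans (dF _).
have [p [_ clp]] := cX (x @ \oo) _ filterT.
exists p => k; apply: cF => B pB.
by apply: clp => //; exists k => // j /= kj; exact: mF (Fx j).
Qed.

Lemma clopen_locally_constant (X : topologicalType) (I : Type) (f : X -> I) (i : I) :
  (forall j, open (f @^-1` [set j])) -> clopen (f @^-1` [set i]).
Proof.
move=> fo; split=> //; rewrite -openC.
have -> : ~` (f @^-1` [set i]) = \bigcup_(j in ~` [set i]) (f @^-1` [set j]).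
  apply/seteqP; split=> [x /= xi|x [j ji fx] /= xi]; first by exists (f x).
  exact: ji (etrans (esym fx) xi).
exact: bigcup_open.
Qed.

Lemma lebesgue_number (R : realType) (X : metricType R) (U : X -> set X) :
  compact [set: X] -> (forall x, nbhs x (U x)) ->
  exists2 d : R, 0 < d & forall y, exists x, ball y d `<=` U x.
Proof.
move=> /compact_near_coveringP cX UP.
have : \forall d \near (0 : R)^'+, [set: X] `<=` [set y | exists x, ball y d `<=` U x].
  apply: cX => x _; have /nbhs_ballP[e /= e0 eU] := UP x.
  exists (ball x (e / 2), [set d | d < e / 2]) => [|[y d] /= [xy de]].
    split=> /=; first by apply: nbhsx_ballx; rewrite divr_gt0.
    by apply: nbhs_right_lt; rewrite divr_gt0.
  exists x => z yz; apply: eU; rewrite [e]splitr; apply: ball_triangle xy _.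
  exact: le_ball (ltW de) _ yz.
move=> H; near (0 : R)^'+ => d; exists d => // y.
by have := near H d; apply.
Unshelve. all: by end_near. Qed.

Section BoundedMetric.
Context (R : realType) (X : metricType R).
Hypothesis mdist_le1 : forall x y : X, mdist x y <= 1.

Lemma mdist_le_diam (A : set X) x y : A x -> A y -> mdist x y <= diam A.
Proof.
move=> Ax Ay; apply: ub_le_sup; last by exists (x, y).
by exists 1 => _ [[u v] _ <-].
Qed.

Lemma diam_le (A : set X) (e : R) :
  0 <= e -> (forall x y, A x -> A y -> mdist x y <= e) -> diam A <= e.
Proof.
move=> e0 Ae; have [->|/set0P[a Aa]] := eqVneq A set0.
  by rewrite /diam set0X image_set0 sup0.
apply: ge_sup; first by exists (mdist a a), (a, a).
by move=> _ [[u v] [/= Au Av] <-]; exact: Ae.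
Qed.

End BoundedMetric.

(** By perfectness no point is isolated, so [Z] contains a second point. *)
Lemma diam_gt0 (R : realType) (X : metricType R) (Z : set X) :
  (forall x y : X, mdist x y <= 1) -> perfect_set [set: X] ->
  open Z -> Z !=set0 -> 0 < diam Z.
Proof.
move=> le1 [_ lX] oZ [z Zz].
have : limit_point [set: X] z by rewrite lX.
move=> /(_ Z)[|y [yz _ Zy]]; first exact: open_nbhs_nbhs.
apply: lt_le_trans (mdist_le_diam le1 Zy Zz).
by rewrite mdist_gt0.
Qed.

Section PathSpace.
Context (B : ordered_bratteli).

Lemma path_edge_continuous k :
  continuous (fun q : path_space B => path_edge q k : discrete_topology (edge B k)).
Proof.
move=> q.
apply: (@continuous_comp _ (edge_sequences B) _ set_val (proj k)).
  exact: initial_continuous.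
exact: (@proj_continuous nat (fun n => discrete_topology (edge B n)) k).
Qed.

Lemma path_edge_clopen k (A : set (edge B k)) :
  clopen [set q : path_space B | A (path_edge q k)].
Proof.
apply: (preimage_clopen _ (@path_edge_continuous k)).
by split; [exact: discrete_open|exact: discrete_closed].
Qed.

Lemma path_edge_inj (p q : path_space B) :
  (forall k, path_edge p k = path_edge q k) -> p = q.
Proof. by move=> pq; apply: val_inj; apply: functional_extensionality_dep. Qed.

Lemma path_space_hausdorff : hausdorff_space (path_space B).
Proof.
move=> p q pq; apply: path_edge_inj => k; apply: contrapT => kpq.
have [oP cP] := path_edge_clopen [set path_edge p k].
have [r [/= <- //]] := pq [set r | path_edge r k = path_edge p k]
  [set r | path_edge r k <> path_edge p k] (open_nbhs_nbhs (conj oP erefl))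
  (open_nbhs_nbhs (conj (closed_openC cP) (nesym kpq))).
Qed.

Lemma continuous_path_space (X : topologicalType) (f : X -> path_space B) :
  (forall k (e : edge B k), open [set x | path_edge (f x) k = e]) ->
  continuous f.
Proof.
move=> fo; apply: continuous_comp_initial => x.
apply/cvg_sup => k U [V [[W oW <-] Wx] WU].
apply: filterS WU _ => /=.
apply: open_nbhs_nbhs; split=> //.
rewrite [X in open X](_ : _ =
  \bigcup_(e in W) [set x | path_edge (f x) k = e]).
  exact: bigcup_open.
apply/seteqP; split=> [y yW|y [e We ye]]; first by exists (path_edge (f y) k).
by move: We; rewrite -ye.
Qed.

End PathSpace.

Lemma compact_hausdorff_homeomorphism (X Y : topologicalType) (f : X -> Y)
    (g : Y -> X) :
  compact [set: X] -> hausdorff_space Y -> continuous f ->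
  cancel f g -> cancel g f -> homeomorphism f.
Proof.
move=> cX hY fc fK gK; split=> //; exists g; split=> //.
apply/continuous_closedP => A cA.
rewrite [X in closed X](_ : _ = f @` A).
  apply: compact_closed => //; apply: continuous_compact.
    exact: continuous_subspaceT.
  exact: subclosed_compact cA cX _.
apply/seteqP; split=> [y Ay|_ [x Ax <-]]; last by rewrite /preimage/= fK.
by exists (g y).
Qed.

(** * Construction of Kakutani-Rohlin partitions *)

Lemma can_iter (X : Type) (T g : X -> X) l :
  cancel T g -> cancel (iter l T) (iter l g).
Proof. by move=> TK x; elim: l => // l IH; rewrite iterSr iterS TK. Qed.

Section KakutaniRohlinConstruction.
Context (X : topologicalType) (T g : X -> X).
Hypotheses (TK : cancel T g) (gK : cancel g T).
Hypothesis gc : continuous g.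

Lemma image_iter l (A : set X) : iter l T @` A = iter l g @^-1` A.
Proof.
apply/seteqP; split=> [_ [x Ax <-]|x Ax]; first by rewrite /preimage/= can_iter.
by exists (iter l g x); rewrite // can_iter.
Qed.

Lemma iter_continuous (f : X -> X) l : continuous f -> continuous (iter l f).
Proof.
move=> fc; elim: l => [|l IH] x; first exact: cvg_id.
exact: continuous_comp (IH x) (fc (iter l f x)).
Qed.

Lemma clopen_image_iter l (A : set X) : clopen A -> clopen (iter l T @` A).
Proof.
by rewrite image_iter => cA; apply: preimage_clopen => //; exact: iter_continuous.
Qed.

(** The closing condition follows from the partition of [X] into levels. If [T] sent a top level
    point to a positive height, injectivity would place that point one level lower in the same
    tower, hence not at its top. Conversely, a base point whose preimage is not at a top would lie
    at height 0 and at a positive height at once. *)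
Lemma kakutani_rohlin_partition (P : towers X) : X ->
  (forall k : 'I_(ntowers P), (0 < tower_height k)%N /\ clopen (tower_base k)) ->
  partition (@level_index X P) (@level X T P) setT ->
  kakutani_rohlin T P.
Proof.
move=> x0 Pk [cov triv ne]; split=> //.
- have : cover (@level_index X P) (@level X T P) x0 by rewrite cov.
  by move=> [[k l] _ _]; case: (ntowers P) k => [[]|].
- by move=> _ [[k l] _ <-]; apply: clopen_image_iter; case: (Pk k).
apply/seteqP; split=> [x [k _ [y ky <-{x}]]|x [k _ kx]].
  have [hk ck] := Pk k.
  have [[i l] /= li [z iz zE]] : cover (@level_index X P) (@level X T P)
    (iter (tower_height k) T y) by rewrite cov.
  case: l li iz zE => [|l] li /= iz zE; first by exists i; rewrite // -zE.
  rewrite /level_index/= in li.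
  move: zE; rewrite -(prednK hk) /= => /(can_inj TK) E.
  have [ki lE] : (k, (tower_height k).-1) = (i, l).
    apply: triv; rewrite /level_index/=; [by rewrite prednK|exact: ltnW|].
    by exists (iter (tower_height k).-1 T y); split; [exists y|exists z].
  by subst i; move: li; rewrite -lE prednK// ltnn.
have [[i l] /= li [z iz]] : cover (@level_index X P) (@level X T P) (g x) by rewrite cov.
rewrite /level_index/= in li => zE.
have xE : x = iter l.+1 T z by rewrite /= zE gK.
move: li; rewrite leq_eqVlt => /predU1P[lE|li].
  by exists i => //; exists z; rewrite // -lE -xE.
have // : (k, 0%N) = (i, l.+1).
apply: triv => //=; first by rewrite /level_index/=; case: (Pk k).
by exists x; split; [exists x|exists z].
Qed.

Lemma kakutani_rohlin_family (V : finType) (h : V -> nat) (B : V -> set X) : X ->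
  (forall v, (0 < h v)%N) -> (forall v, clopen (B v)) ->
  (forall x, exists v l, (l < h v)%N /\ (iter l T @` B v) x) ->
  (forall v w k l, (k < h v)%N -> (l < h w)%N ->
     iter k T @` B v `&` iter l T @` B w !=set0 -> v = w /\ k = l) ->
  exists P : towers X,
    [/\ kakutani_rohlin T P, (ntowers P <= #|V|)%N,
        base P = \bigcup_v B v &
        forall A, elements T P A ->
          exists v l, (l < h v)%N /\ A = iter l T @` B v].
Proof.
move=> x0 h0 cB cov triv.
(* Empty bases are dropped, since the blocks of a partition are nonempty; hence only an inequality
   for [ntowers]. *)
pose A : {pred V} := fun v => `[< B v !=set0 >].
have AP v x : B v x -> v \in A by move=> vx; apply/asboolP; exists x.
pose P := Towers (fun i : 'I_#|A| => h (enum_val i)) (fun i => B (enum_val i)).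
exists P; split; last 1 first.
- by move=> _ [[i l] li <-]; exists (enum_val i), l.
- apply: kakutani_rohlin_partition => //; first by move=> k; split; [exact: h0|exact: cB].
  split.
  + apply/seteqP; split=> // x _; have [v [l [lv [y vy yx]]]] := cov x.
    have vA := AP _ _ vy.
    exists (enum_rank_in vA v, l); first by rewrite /level_index/= enum_rankK_in.
    by exists y => //=; rewrite enum_rankK_in.
  + move=> [i k] [j l] /= ki lj ne.
    by have [/enum_val_inj/= -> /= ->] := triv _ _ _ _ ki lj ne.
  + move=> [i l] _; have /asboolP[x ix] := enum_valP i.
    by exists (iter l T x), x.
- exact: max_card.
- apply/seteqP; split=> x [v _ vx]; first by exists (enum_val v).
  by have vA := AP _ _ vx; exists (enum_rank_in vA v) => //=; rewrite enum_rankK_in.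
Qed.

(* [T y] in [U] is required of the last point [y] of a tower, rather than a
   first return of the bottom point, so that all heights are positive. *)
Lemma kakutani_rohlin_return (V : finType) (U : set X) (c : X -> V) : X ->
  (forall v, clopen [set x | U x /\ c x = v]) ->
  (forall x, exists l, U (T (iter l T x))) ->
  (forall x, exists y l, U y /\ x = iter l T y) ->
  (forall x y l, U x -> U y -> c x = c y ->
     (forall j, (j < l)%N -> ~ U (T (iter j T x))) ->
     U (T (iter l T x)) -> U (T (iter l T y))) ->
  exists P : towers X,
    [/\ kakutani_rohlin T P, (ntowers P <= #|V|)%N, base P = U &
        forall A, elements T P A -> exists v l, forall z, A z ->
          exists x, [/\ U x, c x = v, z = iter l T x &
            forall j, (j < l)%N -> ~ U (T (iter j T x))]].
Proof.
move=> x0 cU fwd bwd cst.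
have rP x : {l | U (T (iter l T x)) & forall j, (j < l)%N -> ~ U (T (iter j T x))}.
  have ex : exists l, `[< U (T (iter l T x)) >].
    by have [l xl] := fwd x; exists l; exact/asboolP.
  case: (ex_minnP ex) => l /asboolP Ul lmin; exists l => // j + /asboolP/lmin.
  by rewrite ltnNge => /negP.
pose r x := s2val (rP x).
have rU x : U (T (iter (r x) T x)) by exact: (s2valP (rP x)).
have rmin x j : (j < r x)%N -> ~ U (T (iter j T x)) by exact: (s2valP' (rP x)).
(* Used in both directions: on [U] the return time depends on the colour [c x] only. *)
have r_le x y : U x -> U y -> c x = c y -> (r y <= r x)%N.
  move=> Ux Uy xy; rewrite leqNgt; apply/negP => /rmin; apply.
  by apply: (cst x y) => //; exact: rmin.
pose B v := [set x | U x /\ c x = v].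
(* If [B v] is empty, [xget] yields [x0] and the height is arbitrary but positive; the tower is then
   empty anyway. *)
pose h v := (r (xget x0 (B v))).+1.
have hE v x : B v x -> h v = (r x).+1.
  move=> vx; have [Uy yv] : B v (xget x0 (B v)) by exact: xgetI vx.
  have [Ux xv] := vx.
  by congr _.+1; apply/eqP; rewrite eqn_leq !r_le// xv yv.
(* A coincidence would make [y] return to [U] after [l - k] steps, before its first return. *)
have first_return w k l x y : (k < l)%N -> (l < h w)%N -> B w y -> U x ->
    iter k T x <> iter l T y.
  move=> kl lw wy Ux xy; have := hE _ _ wy => hw.
  have lk : l = (k + (l - k.+1).+1)%N by rewrite subnSK// subnKC// ltnW.
  have E : x = T (iter (l - k.+1) T y).
    rewrite -iterS; apply: (can_inj (can_iter k TK)).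
    by rewrite xy {1}lk iterD.
  apply: (@rmin y (l - k.+1)%N); last by rewrite -E.
  by rewrite -ltnS subnSK//; apply: leq_ltn_trans (leq_subr _ _) _; rewrite -hw.
have [//|v|x|v w k l kv lw [z [[x vx xz] [y wy yz]]]|P [krP nP bP eP]] :=
  @kakutani_rohlin_family V h B x0.
- exact: cU.
- have [y [l [Uy ->]]] := bwd x.
  (* When [l] exceeds the return time of [y], the starting point moves on to the first return of
     [y], which shortens [l]. *)
  elim/ltn_ind: l y Uy => l IH y Uy.
  have [lr|rl] := leqP l (r y).
    by exists (c y), l; split; [rewrite (hE _ y)|exists y].
  have lt : (l - (r y).+1 < l)%N by rewrite ltn_subrL (leq_ltn_trans _ rl).
  have [v [j [jv yj]]] := IH _ lt _ (rU y).
  by exists v, j; split=> //; move: yj; rewrite -iterS -iterD subnK.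
- have [kl|lk|kl] := ltngtP k l.
  + by case: (@first_return w k l x y kl lw wy); [case: vx|rewrite xz].
  + by case: (@first_return v l k y x lk kv vx); [case: wy|rewrite xz].
  + subst l; split=> //.
    have E : x = y by apply: (can_inj (can_iter k TK)); rewrite xz.
    by case: vx wy => _ <- [_ <-]; rewrite E.
exists P; split=> //.
  rewrite bP; apply/seteqP; split=> [x [v _ []]//|x Ux].
  by exists (c x).
move=> A /eP[v [l [lv ->]]]; exists v, l => _ [x vx <-]; exists x.
have [Ux xv] := vx; split=> // j jl; apply: rmin.
by rewrite -ltnS -(hE _ _ vx) (leq_trans _ lv).
Qed.

End KakutaniRohlinConstruction.

(** * From Bratteli diagrams to small towers *)

Lemma compact_nested_sub (X : topologicalType) (F : nat -> set X) (O : set X) :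
  compact [set: X] -> (forall k, closed (F k)) -> (forall k, F k.+1 `<=` F k) ->
  open O -> (forall x, (forall k, F k x) -> O x) -> exists k, F k `<=` O.
Proof.
move=> cX cF dF oO FO; apply: contrapT => /forallNP nF.
have [||k|x Fx] := @compact_nested X (fun k => F k `&` ~` O) cX.
- by move=> k; apply: closedI => //; exact: open_closedC.
- by move=> k; have /existsNP[x /not_implyP[Fx Ox]] := nF k; exists x.
- by move=> x [/dF].
by have [_ /(_ (FO x (fun k => (Fx k).1)))] := Fx 0%N.
Qed.

Section BratteliTowers.
Context (B : ordered_bratteli) (X : topologicalType) (T g : X -> X).
Context (phi : X -> path_space B).
Hypotheses (TK : cancel T g) (gK : cancel g T).
Hypothesis gc : continuous g.
Hypotheses (phic : continuous phi) (phi_inj : injective phi).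
Hypothesis Bsimple : essentially_simple B.
Hypothesis phiT : forall x, phi (T x) = vershik (phi x).

Let p x k := path_edge (phi x) k.

Definition max_upto m x := forall i, (i < m)%N -> max_edge (p x i).
Definition min_upto m x := forall i, (i < m)%N -> min_edge (p x i).
Definition agree m x y := forall i, (i < m)%N -> p x i = p y i.
Definition vertex_at m x := src B (p x m).

Let rng_src x k : rng B (p x k) = src B (p x k.+1).
Proof. exact: (set_valP (phi x) k). Qed.

Lemma graph_step x : vershik_graph (phi x) (phi (T x)).
Proof. by rewrite phiT; exact: vershikP. Qed.

(** Let [k] be the edge that the Vershik map replaces by its successor. If [m <= k], the prefix is
    maximal before and minimal after. If [k < m], both sides fail: edge [k] was not maximal, and a
    successor is not minimal. *)
Lemma min_uptoT m x : min_upto m (T x) <-> max_upto m x.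
Proof.
split=> [mTx|mx].
  have [[xmax _] i _|[k [kmax kN [ek nk _] _ _]]] := graph_step x; first exact: xmax.
  have [mk i im|km] := leqP m k; first by apply: kmax; exact: leq_trans mk.
  by case: nk; apply/esym/(mTx k km).
have [[_ Tmin] i _|[k [kmax kN _ Tmin _]]] := graph_step x; first exact: Tmin.
have [mk i im|km] := leqP m k; first by apply: Tmin; exact: leq_trans mk.
by case: kN; exact: mx.
Qed.

Lemma step_tail m x : ~ max_upto m x ->
  forall i, (m <= i)%N -> p (T x) i = p x i.
Proof.
move=> mx i mi; have [[xmax _]|[k [kmax _ _ _ kT]]] := graph_step x.
  by case: mx => j _; exact: xmax.
have [mk|km] := leqP m k; last by apply: kT; exact: leq_trans mi.
by case: mx => j jm; apply: kmax; exact: leq_trans mk.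
Qed.

(** Each vertex receives only one minimal edge, so the prefix is recovered downwards from its last
    vertex. *)
Lemma min_agree m x y : min_upto m x -> min_upto m y ->
  vertex_at m x = vertex_at m y -> agree m x y.
Proof.
elim: m => // m IH mx my vxy.
have exy : p x m = p y m.
  by apply: min_edge_inj; [rewrite !rng_src|exact: mx|exact: my].
move=> i; rewrite ltnS leq_eqVlt => /predU1P[->//|]; apply: IH.
- by move=> j jm; apply: mx; exact: ltnW.
- by move=> j jm; apply: my; exact: ltnW.
- by rewrite /vertex_at exy.
Qed.

(** The first non-maximal edge has the same index below [m] in both prefixes, so its successor, and
    the minimal path put under it, coincide as well. *)
Lemma step_agree m x y : ~ max_upto m x -> agree m x y ->
  vertex_at m x = vertex_at m y -> agree m (T x) (T y).
Proof.
move=> mx xy vxy.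
have my : ~ max_upto m y by move=> my; apply: mx => i im; rewrite xy//; exact: my.
have vT : vertex_at m (T x) = vertex_at m (T y) by rewrite /vertex_at !(@step_tail m)//.
have [[xmax _]|[k [kmax kN kS Tmin kT]]] := graph_step x.
  by case: mx => j _; exact: xmax.
have km : (k < m)%N.
  by rewrite ltnNge; apply/negP => mk; apply: mx => i im; apply: kmax; exact: leq_trans mk.
have [[ymax _]|[l [lmax lN lS Tmin' lT]]] := graph_step y.
  by case: my => j _; exact: ymax.
have lm : (l < m)%N.
  by rewrite ltnNge; apply/negP => ml; apply: my => i im; apply: lmax; exact: leq_trans ml.
rewrite -/(p x k) in kN kS; rewrite -/(p y l) in lN lS.
have kl : k = l.
  apply/eqP; rewrite eqn_leq; apply/andP; split; rewrite leqNgt.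
    by apply/negP => lk; apply: lN; rewrite -xy//; exact: kmax.
  by apply/negP => lk; apply: kN; rewrite xy//; exact: lmax.
subst l.
have eT : p (T x) k = p (T y) k.
  by rewrite xy// in kS; exact: succ_edge_inj kS lS.
have kagree : agree k (T x) (T y).
  by apply: min_agree; rewrite // /vertex_at eT.
move=> i im; have [ik|ki|->//] := ltngtP i k; first exact: kagree.
by rewrite /p kT// lT//; exact: xy.
Qed.

(** As in an odometer: once the first [m] edges are maximal, one more step replaces edge [m] by its
    successor. The inner induction is on the number of edges above edge [m]. *)
Lemma reach_max m x : exists l, max_upto m (iter l T x) /\
  forall i, (m <= i)%N -> p (iter l T x) i = p x i.
Proof.
elim: m x => [|m IH] x; first by exists 0%N.
have [n xn] := ubnP #|[pred e | ele B (p x m) e]|.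
elim: n => // n IHn in x xn *.
have [l [lmax lt]] := IH x.
have [mmax|mN] := pselect (max_edge (p (iter l T x) m)).
  exists l; split=> i; last by move=> mi; apply: lt; exact: ltnW.
  by rewrite ltnS leq_eqVlt => /predU1P[->|/lmax].
have tl : forall i, (m < i)%N -> p (T (iter l T x)) i = p x i.
  move=> i mi; rewrite (@step_tail m.+1)//; first by apply: lt; exact: ltnW.
  by move=> H; apply: mN; exact: H.
have [[xmax _]|[k [kmax kN [ek nk _] _ _]]] := graph_step (iter l T x).
  by case: mN; exact: xmax.
have km : k = m.
  apply/eqP; rewrite eqn_leq; apply/andP; split; rewrite leqNgt.
    by apply/negP => mk; apply: mN; exact: kmax.
  by apply/negP => mk; apply: kN; exact: lmax.
subst k; rewrite -!/(p _ m) lt// in ek nk.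
have [|j [jmax jt]] := IHn (T (iter l T x)).
  rewrite -ltnS; apply: leq_trans xn; rewrite ltnS; apply: proper_card.
  apply/properP; split.
    by apply/fintype.subsetP => e; rewrite !inE; exact: ele_trans.
  exists (p x m); rewrite !inE ?ele_refl//.
  by apply/negP => H; apply: nk; apply: (@ele_anti B); rewrite H ek.
exists (j + l.+1)%N; rewrite iterD; split=> // i mi.
by rewrite jt// tl.
Qed.

(** The same odometer run backwards, with [g y] in place of [T y] and the edges below edge [m] being
    counted. *)
Lemma reach_min m x : exists y l, [/\ min_upto m y, x = iter l T y &
  forall i, (m <= i)%N -> p y i = p x i].
Proof.
elim: m x => [|m IH] x; first by exists x, 0%N.
have [n xn] := ubnP #|[pred e | ele B e (p x m)]|.
elim: n => // n IHn in x xn *.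
have [y [l [ymin xE lt]]] := IH x.
have [mmin|mN] := pselect (min_edge (p y m)).
  exists y, l; split=> // i; last by move=> mi; apply: lt; exact: ltnW.
  by rewrite ltnS leq_eqVlt => /predU1P[->|/ymin].
have [z zy] : exists z, T z = y by exists (g y).
have zN : ~ max_upto m.+1 z.
  by move=> /min_uptoT H; apply: mN; rewrite -zy; exact: H.
have [[_ Tmin]|[k [kmax kN [ek nk _] Tmin _]]] := graph_step z.
  by case: mN; rewrite -zy; exact: Tmin.
have km : k = m.
  apply/eqP; rewrite eqn_leq; apply/andP; split; rewrite leqNgt.
    by apply/negP => mk; apply: mN; rewrite -zy; exact: Tmin.
  apply/negP => mk; rewrite zy in ek nk.
  by apply/nk/esym/(ymin _ mk).
subst k; rewrite -!/(p _ m) zy lt// in ek nk.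
have [|w [j [wmin zE jt]]] := IHn z.
  rewrite -ltnS; apply: leq_trans xn; rewrite ltnS; apply: proper_card.
  apply/properP; split.
    by apply/fintype.subsetP => e; rewrite !inE => ez; exact: ele_trans ez ek.
  exists (p x m); rewrite !inE ?ele_refl//.
  by apply/negP => H; apply: nk; apply: (@ele_anti B); rewrite H ek.
exists w, (l.+1 + j)%N; split=> //.
  by rewrite iterD -zE xE -zy -iterSr.
move=> i mi; rewrite jt// -(lt i (ltnW mi)) -zy.
by rewrite (@step_tail m.+1).
Qed.

Lemma edge_clopen k (A : set (edge B k)) : clopen [set x | A (p x k)].
Proof. exact: (preimage_clopen (path_edge_clopen A) phic). Qed.

Lemma clopen_upto (A : forall k, set (edge B k)) m :
  clopen [set x | forall i, (i < m)%N -> A i (p x i)].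
Proof.
elim: m => [|m IH].
  by rewrite (_ : [set _ | _] = setT) -?subTset//; exact: clopenT.
rewrite (_ : [set _ | _] = [set x | forall i, (i < m)%N -> A i (p x i)]
   `&` [set x | A m (p x m)]); first by apply: clopenI => //; exact: edge_clopen.
apply/seteqP; split=> [x xA|x [xA xm] i].
  by split=> [i im|]; apply: xA => //; exact: ltnW.
by rewrite ltnS leq_eqVlt => /predU1P[->|/xA].
Qed.

Lemma bratteli_towers m : X -> exists P : towers X,
  [/\ kakutani_rohlin T P, (ntowers P <= #|vert B m|)%N,
      base P = min_upto m &
      forall A, elements T P A -> forall x y, A x -> A y -> agree m x y].
Proof.
move=> x0.
(* Two base points with the same vertex run through the same cylinders until they return; this
   yields both the common return time and the agreement on levels. *)
have ret x y l : min_upto m x -> min_upto m y ->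
    vertex_at m x = vertex_at m y ->
    (forall j, (j < l)%N -> ~ min_upto m (T (iter j T x))) ->
    agree m (iter l T x) (iter l T y) /\
    vertex_at m (iter l T x) = vertex_at m (iter l T y).
  move=> mx my vxy; elim: l => [|l IH] H; first by split=> //; exact: min_agree.
  have [|IH1 IH2] := IH; first by move=> j jl; apply: H; exact: ltnW.
  have lN : ~ max_upto m (iter l T x) by move=> /min_uptoT; exact: H.
  have lN' : ~ max_upto m (iter l T y).
    by move=> H'; apply: lN => i im; rewrite IH1//; exact: H'.
  by split=> /=; [exact: step_agree|rewrite /vertex_at !(@step_tail m)//].
have [v|x|x|x y l mx my vxy H|P [krP nP bP eP]] :=
  @kakutani_rohlin_return X T g TK gK gc (vert B m) (min_upto m) (vertex_at m) x0.
- rewrite (_ : [set _ | _] = [set x | min_upto m x] `&` [set x | vertex_at m x = v])//.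
  apply: clopenI; first exact: (clopen_upto (fun k => @min_edge B k)).
  exact: (edge_clopen (fun e => src B e = v)).
- by have [l [lm _]] := reach_max m x; exists l; apply/min_uptoT.
- by have [y [l [ym xE _]]] := reach_min m x; exists y, l.
- have [xy _] := ret x y l mx my vxy H.
  by move=> /min_uptoT xl; apply/min_uptoT => i im; rewrite -xy//; exact: xl.
exists P; split=> // A /eP[v [l Al]] x y /Al[x' [mx vx -> H]] /Al[y' [my vy -> _]].
by have [] := ret x' y' l mx my (etrans vx (esym vy)) H.
Qed.

Lemma agree_eq x y : (forall m, agree m x y) -> x = y.
Proof.
by move=> xy; apply/phi_inj/path_edge_inj => k; exact: (xy k.+1).
Qed.

End BratteliTowers.

(** Uniform continuity of the inverse of [phi]: the cylinders around a point shrink to it, and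
    compactness makes their length uniform. *)
Lemma agree_mdist (R : realType) (X : metricType R) (B : ordered_bratteli)
    (phi : X -> path_space B) (e : R) :
  compact [set: X] -> continuous phi -> injective phi -> 0 < e ->
  exists m, forall x y, agree phi m x y -> mdist x y < e.
Proof.
move=> cX phic phi_inj e0.
have : \forall m \near \oo, [set: X] `<=`
    [set x | forall y, agree phi m x y -> mdist x y < e].
  move/compact_near_coveringP: (cX); apply=> x _.
  have cA m : clopen [set y | agree phi m x y].
    by apply: (clopen_upto phic (fun k => [set e | path_edge (phi x) k = e])).
  have [||y xy|m mx] := @compact_nested_sub X _ (ball x (e / 2))° cX (fun m => (cA m).2).
  - by move=> m y xy i im; apply: xy; exact: leqW.
  - exact: open_interior.
  - rewrite -(agree_eq phi_inj xy); apply: nbhsx_ballx.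
    by rewrite divr_gt0.
  exists ([set y | agree phi m x y], [set k | (m <= k)%N]) => [|[y k] /= [xy mk] z yz].
    by split=> /=; [apply: open_nbhs_nbhs; split=> //; exact: (cA m).1|exists m].
  have /mx/interior_subset/ball_sym ym := xy.
  have /mx/interior_subset zm : agree phi m x z.
    by move=> i im; rewrite (xy i im); apply: yz; exact: leq_trans mk.
  have := ball_triangle ym zm; rewrite -splitr ballEmdist; exact.
by move=> [m _ Hm]; exists m => x; exact: (Hm m (leqnn m) x).
Qed.

Lemma rank_bound_small_towers (R : realType) (X : metricType R) (T : X -> X) (n : nat) :
  compact [set: X] -> (forall x y : X, mdist x y <= 1) -> homeomorphism T ->
  rank_bound T n ->
  exists x : X, forall eps : R, 0 < eps ->
    exists P : towers X,
      [/\ kakutani_rohlin T P /\ (ntowers P <= n)%N,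
          forall A : set X, elements T P A -> diam A < eps,
          diam (base P) < eps &
          base P x].
Proof.
move=> cX le1 [Tc [g [gc TK gK]]].
move=> [B [Bs Bn [phi [phic [psi [psic phiK psiK]]] phiT]]].
have phi_inj := can_inj phiK.
have [xm [xmP xmU]] := Bs.2; exists (psi xm) => eps eps0.
have e0 : 0 < eps / 2 by rewrite divr_gt0.
(* A base within [eps / 2 / 2] of [psi xm] has diameter at most [eps / 2], which is strictly below
   [eps]. *)
have e4 : 0 < eps / 2 / 2 by rewrite divr_gt0.
have [m1 m1P] := agree_mdist cX phic phi_inj e0.
have cM m : clopen (min_upto phi m).
  exact: (clopen_upto phic (fun k => @min_edge B k)).
have [||y ym|m2 m2P] := @compact_nested_sub X _ (ball (psi xm) (eps / 2 / 2))° cX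
  (fun m => (cM m).2).
- by move=> m y ym i im; apply: ym; exact: leqW.
- exact: open_interior.
- have -> : y = psi xm.
    by rewrite -[LHS]phiK -(xmU (phi y))// => i; exact: (ym i.+1).
  by apply: nbhsx_ballx; exact: e4.
(* The successor matters: the number of vertices is bounded by [n] only from level 1 on. *)
pose m := (maxn m1 m2).+1.
have phiT' x : phi (T x) = vershik (phi x) by rewrite -[LHS]/((phi \o T) x) phiT.
have [P [krP nP bP eP]] := bratteli_towers TK gK gc phic Bs phiT' m (psi xm).
have half_lt : eps / 2 < eps by rewrite ltr_pdivrMr// ltr_pMr// ltr1n.
exists P; split.
- by split=> //; apply: leq_trans nP _; exact: Bn.
- move=> A PA; apply: le_lt_trans half_lt.
  apply: diam_le => [|x y Ax Ay]; first exact: ltW.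
  apply/ltW/m1P => i im; apply: (eP _ PA x y Ax Ay).
  by rewrite ltnS (leq_trans (ltnW im))// leq_maxl.
- apply: le_lt_trans half_lt; rewrite bP.
  have near_xm x : min_upto phi m x -> ball (psi xm) (eps / 2 / 2) x.
    move=> mx; have /m2P/interior_subset// : min_upto phi m2 x.
    by move=> i im; apply: mx; rewrite ltnS (leq_trans (ltnW im))// leq_maxr.
  apply: diam_le => [|x y /near_xm/ball_sym mx /near_xm my]; first exact: ltW.
  by have := ball_triangle mx my; rewrite -splitr ballEmdist => /ltW.
- by rewrite bP => i im; rewrite psiK; exact: xmP.
Qed.

(** * From small towers to refining partitions *)

Section Translation.
Context (X : topologicalType) (T g : X -> X).
Hypotheses (TK : cancel T g) (gK : cancel g T).
Hypothesis gc : continuous g.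
Context (S S' : X -> X).
Hypotheses (SK : cancel S S') (S'K : cancel S' S) (S'c : continuous S').
Hypothesis ST : S \o T = T \o S.

Definition translate (P : towers X) : towers X :=
  Towers (@tower_height X P) (fun k => S @` tower_base k).

Lemma iter_comm l x : S (iter l T x) = iter l T (S x).
Proof.
elim: l => //= l IH.
by rewrite -[LHS]/((S \o T) (iter l T x)) ST /= IH.
Qed.

Lemma translate_level (P : towers X) (i : 'I_(ntowers P) * nat) :
  @level X T (translate P) i = S @` level T i.
Proof.
rewrite /level/= !image_comp; apply: eq_imagel => x _ /=.
by rewrite iter_comm.
Qed.

Lemma translate_base (P : towers X) : base (translate P) = S @` base P.
Proof. by rewrite /base image_bigcup. Qed.

(** As [S] commutes with [T], it carries levels to levels; in the application it is a power of
    [T]. *)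
Lemma translate_kakutani_rohlin (P : towers X) :
  kakutani_rohlin T P -> kakutani_rohlin T (translate P).
Proof.
move=> [P0 Pk [cov triv ne] _ _].
have imS A : S @` A = S' @^-1` A.
  apply/seteqP; split=> [_ [x Ax <-]|x Ax]; first by rewrite /preimage/= SK.
  by exists (S' x).
have [h0 _] := Pk (Ordinal P0); have [x0 _] := ne (_, 0%N) h0.
apply: (kakutani_rohlin_partition TK gK gc x0).
  move=> k; have [hk ck] := Pk k; split=> //=.
  by rewrite imS; exact: preimage_clopen.
split.
- apply/seteqP; split=> // x _.
  have [i Pi xi] : cover (@level_index X P) (@level X T P) (S' x) by rewrite cov.
  by exists i => //; rewrite translate_level imS.
- move=> i j Pi Pj; rewrite !translate_level !imS => -[x [xi xj]].
  by apply: triv => //; exists (S' x).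
- move=> i Pi; rewrite translate_level; have [x xi] := ne i Pi.
  by exists (S x), x.
Qed.

End Translation.

(** A block of [P] that meets [A] lies in some block of [Q], which then meets [A] and so equals
    [A]. *)
Lemma refines_subset (X : topologicalType) (P Q : set (set X)) :
  (forall x, exists2 C, P C & C x) -> partition Q id setT ->
  (forall C, P C -> exists2 A, Q A & C `<=` A) -> refines P Q.
Proof.
move=> Pcov [_ Qtriv _] PQ A QA.
exists [set C | P C /\ C `<=` A] => [C []//|].
apply/seteqP; split=> [x Ax|x [C [_ CA] Cx]]; last exact: CA.
have [C PC Cx] := Pcov x; have [A' QA' CA'] := PQ C PC.
exists C => //; split=> //.
suff -> : A = A' by [].
by apply: Qtriv => //; exists x; split=> //; exact: CA'.
Qed.

Lemma small_towers_refine (R : realType) (X : metricType R) (T : X -> X) (n : nat) :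
  compact [set: X] -> perfect_set [set: X] -> (forall x y : X, mdist x y <= 1) ->
  homeomorphism T ->
  (exists x : X, forall eps : R, 0 < eps ->
    exists P : towers X,
      [/\ kakutani_rohlin T P /\ (ntowers P <= n)%N,
          forall A : set X, elements T P A -> diam A < eps,
          diam (base P) < eps &
          base P x]) ->
  forall (Z : set X) (Q : set (set X)),
    clopen Z -> finite_covering T Z -> clopen_finite_partition Q ->
    exists P : towers X,
      [/\ kakutani_rohlin T P /\ (ntowers P <= n)%N,
          base P `<=` Z,
          diam (base P) <= diam Z / 2 &
          refines (elements T P) Q].
Proof.
move=> cX pX le1 [Tc [g [gc TK gK]]] [x xP] Z Q [oZ cZ] [N covZ] [_ Qpart Qclopen].
(* Finite covering places [x] in some T^m Z, and [S] is T^-m. *)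
have [S [S' [SK S'K Sc S'c [ST Zx]]]] : exists S S' : X -> X,
    [/\ cancel S S', cancel S' S, continuous S, continuous S' &
      S \o T = T \o S /\ Z (S x)].
  have [[k|k] _] : (\bigcup_(m in [set m : int | - N%:Z <= m <= N%:Z]) zimage T m Z) x.
    by rewrite covZ.
  - move=> [z Zz zx]; exists (iter k g), (iter k T).
    split; [exact: can_iter|exact: can_iter|exact: iter_continuous|exact: iter_continuous|].
    split; last by rewrite -zx can_iter.
    by apply/funext => y /=; apply: (can_inj gK); rewrite TK -iterS iterSr TK.
  - move=> Zx; exists (iter k.+1 T), (iter k.+1 g).
    split; [exact: can_iter|exact: can_iter|exact: iter_continuous|exact: iter_continuous|].
    by split=> //; apply/funext => y; rewrite /comp -iterSr.
have Z0 : 0 < diam Z by apply: diam_gt0 => //; exists (S x).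
(* A quarter of the diameter: a base inside a ball of radius [e] around [S x] has diameter at most
   [2 * e], that is diam Z / 2. *)
pose e := diam Z / 2 / 2.
have e0 : 0 < e by rewrite !divr_gt0.
have /nbhs_ballP[d1 /= d10 d1P] : nbhs x (S @^-1` (Z `&` ball (S x) e)).
  apply: Sc; apply: filterI; first exact: open_nbhs_nbhs.
  exact: nbhsx_ballx.
have [Qcov _ _] := Qpart.
have /choice[q qP] : forall y, exists A, Q A /\ A (S y).
  move=> y.
  have [A QA Ay] : cover Q id (S y) by rewrite Qcov.
  by exists A.
(* A Lebesgue number for the cover by the preimages of blocks: sets of diameter below [d2] are
   mapped by [S] into one block of [Q]. *)
have [y|d2 d20 d2P] := @lebesgue_number R X (fun y => S @^-1` q y) cX.
  have [Qq qSy] := qP y.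
  by apply: Sc; apply: open_nbhs_nbhs; split=> //; case: (Qclopen _ Qq).
have eps0 : 0 < Num.min d1 d2 by rewrite lt_min d10.
have [P [[krP nP] eP bP Px]] := xP _ eps0.
have baseP b : base P b -> Z (S b) /\ ball (S x) e (S b).
  move=> Pb; apply: d1P; rewrite ballEmdist /=.
  apply: le_lt_trans (mdist_le_diam le1 Px Pb) _.
  by apply: lt_le_trans bP _; rewrite ge_min lexx.
exists (translate S P); split.
- by split=> //; exact: (translate_kakutani_rohlin TK gK gc SK S'K S'c ST).
- by rewrite translate_base => _ [b /baseP[Zb _] <-].
- rewrite translate_base; apply: diam_le => [|_ _ [b /baseP[_ be] <-] [c /baseP[_ ce] <-]].
    by rewrite divr_ge0// ltW.
  by have := ball_triangle (ball_sym be) ce; rewrite -splitr ballEmdist => /ltW.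
- have [_ _ [Pcov _ Pne] _ _] := krP.
  apply: refines_subset => // [y|_ [i Pi <-]].
    have [i Pi yi] : cover (@level_index X P) (@level X T P) (S' y) by rewrite Pcov.
    exists (@level X T (translate S P) i); first by exists i.
    by rewrite (translate_level ST); exists (S' y).
  rewrite (translate_level ST); have [y yi] := Pne i Pi.
  have [z yz] := d2P y; exists (q z); first by case: (qP z).
  move=> _ [w wi <-]; apply: yz; rewrite ballEmdist /=.
  apply: le_lt_trans (mdist_le_diam le1 yi wi) _.
  apply: lt_le_trans (eP _ _) _; first by exists i.
  by rewrite ge_min lexx orbT.
Qed.

(** * Position of a point in a Kakutani-Rohlin partition *)

Section Location.
Context (X : topologicalType) (T g : X -> X).
Hypotheses (TK : cancel T g) (gK : cancel g T).
Context (P : towers X) (krP : kakutani_rohlin T P).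

Lemma locate_ex x : exists2 i, level_index i & @level X T P i x.
Proof.
have [_ _ [Pcov _ _] _ _] := krP.
by have : cover (@level_index X P) (@level X T P) x by rewrite Pcov.
Qed.

(** The tower and the height of [x]. The elements of the partition are the nonempty fibres of [loc],
    so refinement can be stated as one location determining another. *)
Definition loc x : 'I_(ntowers P) * nat := s2val (cid2 (locate_ex x)).

Lemma loc_index x : ((loc x).2 < tower_height (loc x).1)%N.
Proof. exact: (s2valP (cid2 (locate_ex x))). Qed.

Lemma loc_level x : level T (loc x) x.
Proof. exact: (s2valP' (cid2 (locate_ex x))). Qed.

Lemma loc_unique i x : level_index i -> level T i x -> loc x = i.
Proof.
move=> Pi xi; have [_ _ [_ triv _] _ _] := krP.
by apply: triv => //; [exact: loc_index|exists x; split=> //; exact: loc_level].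
Qed.

Lemma base_loc x : base P x <-> (loc x).2 = 0%N.
Proof.
split=> [[k _ xk]|x0].
  rewrite (@loc_unique (k, 0%N))//; last by exists x.
  by have [_ /(_ k)[]] := krP.
have := loc_level x; rewrite /level x0 /= => -[y yk <-].
by exists (loc x).1.
Qed.

Lemma loc_iter s x : ((loc x).2 + s < tower_height (loc x).1)%N ->
  loc (iter s T x) = ((loc x).1, ((loc x).2 + s)%N).
Proof.
move=> lt; apply: loc_unique => //; have [y yk /= yx] := loc_level x.
by exists y => //=; rewrite addnC iterD yx.
Qed.

Lemma loc_top x : ((loc x).2.+1 = tower_height (loc x).1)%N -> base P (T x).
Proof.
move=> top; have [_ _ _ _ <-] := krP; have [y yk /= yx] := loc_level x.
by exists (loc x).1 => //; exists y => //; rewrite -top /= yx.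
Qed.

Lemma top_loc x : base P (T x) -> ((loc x).2.+1 = tower_height (loc x).1)%N.
Proof.
move=> /base_loc Tx; have := loc_index x; rewrite leq_eqVlt => /predU1P[//|lt].
by have := @loc_iter 1 x; rewrite addn1 => /(_ lt) E; rewrite E in Tx.
Qed.

Lemma loc_next x : ~ base P (T x) -> loc (T x) = ((loc x).1, (loc x).2.+1).
Proof.
move=> Tx; have := loc_index x; rewrite leq_eqVlt => /predU1P[/loc_top//|lt].
by have := @loc_iter 1 x; rewrite addn1; exact.
Qed.

Lemma loc_iter_next s x :
  (forall t, (0 < t)%N -> (t <= s)%N -> ~ base P (iter t T x)) ->
  loc (iter s T x) = ((loc x).1, ((loc x).2 + s)%N).
Proof.
elim: s => [|s IH] H; first by rewrite addn0; case: (loc x).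
rewrite iterS loc_next; last by rewrite -iterS; exact: H.
by rewrite IH /= ?addnS// => t t0 ts; apply: H => //; exact: leqW.
Qed.

Lemma loc_back s x : (s <= (loc x).2)%N ->
  loc (iter s g x) = ((loc x).1, ((loc x).2 - s)%N).
Proof.
move=> sx; have [y yk /= yx] := loc_level x; apply: loc_unique.
  by apply: leq_ltn_trans (leq_subr _ _) _; exact: loc_index.
exists y => //=; rewrite -[RHS](congr1 (iter s g) yx) -[in RHS](subnKC sx) iterD.
by rewrite (can_iter s TK).
Qed.

Lemma loc_back_base x : base P (iter (loc x).2 g x).
Proof. by apply/base_loc; rewrite loc_back//= subnn. Qed.

Lemma clopen_loc i : clopen [set x | loc x = i].
Proof.
have [Pi|nPi] := pselect (level_index i); last first.
  rewrite (_ : [set _ | _] = set0); first exact: clopen0.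
  by apply/seteqP; split=> // x /= xi; apply: nPi; rewrite -xi; exact: loc_index.
have [_ _ _ Pc _] := krP; rewrite (_ : [set _ | _] = level T i).
  by apply: Pc; exists i.
by apply/seteqP; split=> x /= => [<-|]; [exact: loc_level|exact: loc_unique].
Qed.

Lemma base_clopen : clopen (base P).
Proof.
have -> : base P = (fun x => (loc x).2 == 0%N) @^-1` [set true].
  by apply/seteqP; split=> x; [move=> /base_loc/= ->|move=> /eqP/base_loc].
apply: clopen_locally_constant => b.
rewrite [X in open X](_ : _ =
  \bigcup_(i in [set i | (i.2 == 0%N) = b]) [set x | loc x = i]).
  by apply: bigcup_open => i _; exact: (clopen_loc i).1.
apply/seteqP; split=> [x /= xb|x [i ib /= xi]]; first by exists (loc x).
by rewrite /preimage/= xi.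
Qed.

Lemma base_ex : exists x, base P x.
Proof.
have [P0 Pk [_ _ Pne] _ _] := krP; have [h0 _] := Pk (Ordinal P0).
have [_ [x xk _]] := Pne (_, 0%N) h0.
by exists x, (Ordinal P0).
Qed.

(** Every point is fewer steps above the base than the largest height. This allows the base of one
    partition to serve as [Z] for the next. *)
Lemma base_finite_covering : finite_covering T (base P).
Proof.
exists (\max_k tower_height (k : 'I_(ntowers P))).
apply/seteqP; split=> // x _.
exists (Posz (loc x).2) => /=.
  rewrite (le_trans _ (_ : 0 <= _))//= lez_nat.
  by apply/ltnW/(leq_trans (loc_index x)); exact: leq_bigmax.
by exists (iter (loc x).2 g x); [exact: loc_back_base|rewrite (can_iter _ gK)].
Qed.

End Location.

(** * Sequences of refining partitions *)

Lemma fibres_partition (X : topologicalType) (I : Type) (f : X -> I) :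
  finite_set (range f) -> (forall i, open (f @^-1` [set i])) ->
  clopen_finite_partition ((fun i => f @^-1` [set i]) @` range f).
Proof.
move=> finf fo; split.
- exact: finite_image.
- split.
  + apply/seteqP; split=> // x _; exists (f @^-1` [set f x]) => //.
    by exists (f x).
  + by move=> _ _ [i _ <-] [j _ <-] [x [/= <- <-]].
  + by move=> _ [_ [x _ <-] <-]; exists x.
- by move=> _ [i _ <-]; exact: clopen_locally_constant.
Qed.

Lemma finite_level_index (X : topologicalType) (P : towers X) : finite_set (@level_index X P).
Proof.
apply: (@sub_finite_set _ _ ([set: 'I_(ntowers P)] `*`
    `I_(\max_k tower_height (k : 'I_(ntowers P))))).
  by move=> i /= Pi; split=> //; apply: leq_trans Pi _; exact: leq_bigmax.
by apply: finite_setX => //; exact: finite_finset.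
Qed.

Definition kr_partition (X : topologicalType) (T : X -> X) :=
  {P : towers X | kakutani_rohlin T P}.

Definition loc_of (X : topologicalType) (T : X -> X) (P : kr_partition T) x :=
  loc (svalP P) x.

Section RefiningSequence.
Context (R : realType) (X : metricType R) (T g : X -> X) (n : nat).
Hypotheses (TK : cancel T g) (gK : cancel g T).
Hypothesis refine : forall (Z : set X) (Q : set (set X)),
  clopen Z -> finite_covering T Z -> clopen_finite_partition Q ->
  exists P : towers X,
    [/\ kakutani_rohlin T P /\ (ntowers P <= n)%N,
        base P `<=` Z,
        diam (base P) <= diam Z / 2 &
        refines (elements T P) Q].

(** [U] is a clopen set that [P'] must resolve besides refining [P]; letting it range over all
    clopen sets separates points. *)
Definition finer (U : set X) (P P' : kr_partition T) : Prop :=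
  [/\ (ntowers (sval P') <= n)%N,
      base (sval P') `<=` base (sval P),
      diam (base (sval P')) <= diam (base (sval P)) / 2 &
      forall x y, loc_of P' x = loc_of P' y ->
        loc_of P x = loc_of P y /\ (U x <-> U y)].

(** Condition (3) is applied with the base of [P] as [Z] and the fibres of [f], position in [P]
    together with membership in [U], as [Q]. *)
Lemma finer_ex U P : clopen U -> exists P', finer U P P'.
Proof.
move=> cU; pose f x := (loc_of P x, `[< U x >]).
have fo i : open (f @^-1` [set i]).
  case: i => i b.
  rewrite (_ : _ @^-1` _ =
    [set x | loc_of P x = i] `&` (fun x => `[< U x >]) @^-1` [set b]).
    apply: openI; first exact: (clopen_loc (svalP P) i).1.
    case: b; last first.
      rewrite (_ : _ @^-1` _ = ~` U); first exact: (clopenC U cU).1.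
      apply/seteqP; split=> x /= => [Ux|/asboolPn/negbTE//].
      by apply/asboolPn; rewrite Ux.
    rewrite (_ : _ @^-1` _ = U); first exact: cU.1.
    apply/seteqP; split=> x /= => [Ux|/asboolP//].
    by apply/asboolP; rewrite Ux.
  by apply/seteqP; split=> [x /= [-> ->]//|x /= []]; rewrite /preimage/= /f => -> ->.
have ff : finite_set (range f).
  apply: (@sub_finite_set _ _ (@level_index X (sval P) `*` [set: bool])).
    by move=> _ [x _ <-]; split=> //; exact: (loc_index (svalP P)).
  by apply: finite_setX; [exact: finite_level_index|exact: finite_finset].
have [P' [[krP' nP'] bP' dP' rP']] := refine (base_clopen (svalP P))
  (base_finite_covering TK gK (svalP P)) (fibres_partition ff fo).
pose PP : kr_partition T := exist _ P' krP'.
exists PP; split=> // x y xy.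
have [|S SP' SE] := rP' (f @^-1` [set f x]); first by exists (f x).
have : (f @^-1` [set f x]) x by [].
rewrite SE => -[C SC Cx].
have : (f @^-1` [set f x]) y.
  rewrite SE; exists C => //; have [i Pi iC] := SP' _ SC.
  rewrite -iC in Cx *; rewrite -(loc_unique (svalP PP) Pi Cx).
  by rewrite -[loc _ x]/(loc_of PP x) xy; exact: loc_level.
move=> /= [-> /esym UE]; split=> //.
by split=> /asboolP; [rewrite UE|rewrite -UE] => /asboolP.
Qed.

Lemma refining_sequence (x0 : X) (U : nat -> set X) :
  (forall k, clopen (U k)) ->
  exists P : nat -> kr_partition T,
    [/\ ntowers (sval (P 0%N)) = 1%N, base (sval (P 0%N)) = setT &
        forall k, finer (U k) (P k) (P k.+1)].
Proof.
move=> cU; pose P0 : towers X := Towers (fun _ : 'I_1 => 1%N) (fun _ => [set: X]).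
have krP0 : kakutani_rohlin T P0.
  have lE i : @level_index X P0 i -> level T i = [set: X].
    case: i => i [|//] _; apply/seteqP; split=> // x _.
    by exists x.
  split=> //.
  - by move=> k; split=> //; exact: clopenT.
  - split.
    + by apply/seteqP; split=> // x _; exists (ord0, 0%N); rewrite ?lE.
    + by move=> [i [|//]] [j [|//]] _ _ _; rewrite [i]ord1 [j]ord1.
    + by move=> i Pi; rewrite lE//; exists x0.
  - by move=> _ [i Pi <-]; rewrite lE//; exact: clopenT.
  - apply/seteqP; split=> x _; first by exists ord0.
    by exists ord0 => //; exists (g x).
have /choice[f fP] : forall kP : nat * kr_partition T, exists P', finer (U kP.1) kP.2 P'.
  by move=> [k P]; exact: finer_ex.
pose P := nat_rect (fun=> kr_partition T) (exist _ P0 krP0) (fun k P => f (k, P)).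
exists P; split=> //; last by move=> k; exact: (fP (k, P k)).
by apply/seteqP; split=> // x _; exists ord0.
Qed.

End RefiningSequence.

(** * The Bratteli diagram of a refining sequence *)

Section TowerDiagram.
Context (X : topologicalType) (T g : X -> X).
Hypotheses (TK : cancel T g) (gK : cancel g T).
Context (P : nat -> kr_partition T).
Hypothesis P0_ntowers : ntowers (sval (P 0%N)) = 1%N.
Hypothesis P0_base : base (sval (P 0%N)) = setT.
Hypothesis base_decr : forall k, base (sval (P k.+1)) `<=` base (sval (P k)).
Hypothesis loc_refine : forall k x y,
  loc_of (P k.+1) x = loc_of (P k.+1) y -> loc_of (P k) x = loc_of (P k) y.
Hypothesis loc_separate : forall x y,
  (forall k, loc_of (P k) x = loc_of (P k) y) -> x = y.
Hypothesis base_point : forall x y,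
  (forall k, base (sval (P k)) x) -> (forall k, base (sval (P k)) y) -> x = y.
Hypothesis X_compact : compact [set: X].

Let tw k x := (loc_of (P k) x).1.
Let lv k x := (loc_of (P k) x).2.
Let base_at k := base (sval (P k)).
Let height k (i : 'I_(ntowers (sval (P k)))) := tower_height i.

Let baseE k x : base_at k x <-> lv k x = 0%N.
Proof. exact: base_loc. Qed.

Let base_le k l x : (k <= l)%N -> base_at l x -> base_at k x.
Proof.
elim: l => [|l IH]; first by rewrite leqn0 => /eqP ->.
by rewrite leq_eqVlt => /predU1P[->//|/IH kl] /base_decr.
Qed.

Let lv0 x : lv 0 x = 0%N.
Proof. by apply/baseE; rewrite /base_at P0_base. Qed.

Let tw0 x y : tw 0 x = tw 0 y.
Proof.
have ord1E m (i j : 'I_m) : m = 1%N -> i = j.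
  by move=> m1; subst m; rewrite [i]ord1 [j]ord1.
exact: ord1E.
Qed.

(** The latest point of the backward orbit of [x], counting [x] itself, in the base of [P k]. *)
Definition bottom k x := iter (lv k x) g x.

Let bottom_base k x : base_at k (bottom k x).
Proof. exact: (loc_back_base TK). Qed.

(** Descending [lv k.+1 x] steps reaches the base of [P k.+1], hence that of [P k], which is
    impossible in fewer than [lv k x] steps. *)
Let lv_le k x : (lv k x <= lv k.+1 x)%N.
Proof.
rewrite leqNgt; apply/negP => lt.
have /base_decr/baseE := @bottom_base k.+1 x.
rewrite /bottom /lv /loc_of (loc_back TK)/=; last exact: ltnW.
by apply/eqP; rewrite subn_eq0 -ltnNge.
Qed.

Let tw_bottom k x : tw k (bottom k x) = tw k x.
Proof. by rewrite /tw /loc_of (loc_back TK). Qed.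

Let loc_bottom k x :
  loc_of (P k.+1) (bottom k x) = (tw k.+1 x, (lv k.+1 x - lv k x)%N).
Proof. by rewrite /loc_of (loc_back TK)//; exact: lv_le. Qed.

(** A common bound on the heights, so that the edges form a [finType]. *)
Let hmax k := \max_i height (i : 'I_(ntowers (sval (P k)))).

Let lv_lt k x : (lv k x < hmax k)%N.
Proof. by apply: leq_trans (loc_index (svalP (P k)) x) _; exact: leq_bigmax. Qed.

(* The edge (j, l) at level [k] stands for the visit of the [j]-th tower of
   [P k.+1] to the base of [P k] at height [l]. *)
Definition is_tower_edge k (e : 'I_(ntowers (sval (P k.+1))) * 'I_(hmax k.+1)) :=
  `[< exists2 x, loc_of (P k.+1) x = (e.1, e.2 : nat) & base_at k x >].

Definition tower_edge k : finType :=
  {e : 'I_(ntowers (sval (P k.+1))) * 'I_(hmax k.+1) | is_tower_edge e}.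

Lemma tower_edge_ex k (e : tower_edge k) :
  exists2 x, loc_of (P k.+1) x = ((val e).1, (val e).2 : nat) & base_at k x.
Proof. exact/asboolP/(valP e). Qed.

(** The chosen witness is immaterial: a position in [P k.+1] determines the tower of [P k]. *)
Definition tower_src k (e : tower_edge k) := tw k (s2val (cid2 (tower_edge_ex e))).

Definition tower_rng k (e : tower_edge k) := (val e).1.

Definition tower_ele k : rel (tower_edge k) := fun e f =>
  ((val e).1 == (val f).1) && ((val e).2 <= (val f).2)%N.

Fact edge_through_subproof k (x : X) :
  is_tower_edge (tw k.+1 (bottom k x), Ordinal (lv_lt k.+1 (bottom k x))).
Proof.
apply/asboolP; exists (bottom k x); last exact: bottom_base.
by rewrite /= /tw /lv; case: (loc_of _ _).
Qed.

(** The passage through a tower of [P k] during which the orbit visits [x]; it begins at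
    [bottom k x]. *)
Definition edge_through k (x : X) : tower_edge k :=
  exist (fun e => is_tower_edge e) _ (edge_through_subproof k x).

Lemma edge_through1 k x : (val (edge_through k x)).1 = tw k.+1 x.
Proof. by rewrite /= /tw loc_bottom. Qed.

Lemma edge_through2 k x :
  (val (edge_through k x)).2 = (lv k.+1 x - lv k x)%N :> nat.
Proof. by rewrite /= /lv loc_bottom. Qed.

Lemma tower_edge_eq k (e f : tower_edge k) :
  (val e).1 = (val f).1 -> (val e).2 = (val f).2 :> nat -> e = f.
Proof.
by move=> ef1 /val_inj ef2; apply: val_inj; apply/eqP; rewrite -pair_eqE /= ef1 ef2 !eqxx.
Qed.

Lemma tower_srcE k (e : tower_edge k) x :
  loc_of (P k.+1) x = ((val e).1, (val e).2 : nat) -> tower_src e = tw k x.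
Proof.
move=> xe; rewrite /tower_src; case: cid2 => y /= ye _.
by rewrite /tw (@loc_refine k y x)// xe.
Qed.

Lemma tower_edge_base k (e : tower_edge k) x :
  loc_of (P k.+1) x = ((val e).1, (val e).2 : nat) -> base_at k x.
Proof.
move=> xe; have [y ye /baseE yb] := tower_edge_ex e; apply/baseE.
by rewrite /lv (@loc_refine k x y)// xe.
Qed.

Lemma src_edge_through k x : tower_src (edge_through k x) = tw k x.
Proof.
rewrite (@tower_srcE _ _ (bottom k x)) ?tw_bottom//.
by rewrite loc_bottom edge_through1 edge_through2.
Qed.

Lemma rng_edge_through k x : tower_rng (edge_through k x) = tw k.+1 x.
Proof. exact: edge_through1. Qed.

Lemma tw_ex k (i : 'I_(ntowers (sval (P k)))) : exists x, tw k x = i /\ base_at k x.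
Proof.
have [_ Pk [_ _ Pne] _ _] := svalP (P k); have [h0 _] := Pk i.
have [_ [x xi _]] := Pne (i, 0%N) h0; exists x; split; last by exists i.
by rewrite /tw /loc_of (@loc_unique _ _ _ _ (i, 0%N))//; exists x.
Qed.

Fact tower_vert_gt0 k : (0 < #|'I_(ntowers (sval (P k)))|)%N.
Proof. by rewrite card_ord; case: (svalP (P k)). Qed.

Fact tower_edge_gt0 k : (0 < #|tower_edge k|)%N.
Proof.
have [x _] := base_ex (svalP (P k)).
by apply/card_gt0P; exists (edge_through k x).
Qed.

Fact tower_vert0 : #|'I_(ntowers (sval (P 0%N)))| = 1%N.
Proof. by rewrite card_ord. Qed.

Fact tower_src_surj k (v : 'I_(ntowers (sval (P k)))) :
  exists e : tower_edge k, tower_src e = v.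
Proof.
have [x [<- _]] := tw_ex v; exists (edge_through k x).
exact: src_edge_through.
Qed.

Fact tower_rng_surj k (v : 'I_(ntowers (sval (P k.+1)))) :
  exists e : tower_edge k, tower_rng e = v.
Proof.
have [x [<- _]] := tw_ex v; exists (edge_through k x).
exact: rng_edge_through.
Qed.

Fact tower_ele_refl k : reflexive (@tower_ele k).
Proof. by move=> e; rewrite /tower_ele eqxx leqnn. Qed.

Fact tower_ele_anti k : antisymmetric (@tower_ele k).
Proof.
move=> e f /andP[/andP[/eqP ef le] /andP[_ ge]]; apply: tower_edge_eq => //.
by apply/eqP; rewrite eqn_leq le ge.
Qed.

Fact tower_ele_trans k : transitive (@tower_ele k).
Proof.
move=> f e h /andP[/eqP ef le] /andP[/eqP fh le']; apply/andP; split.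
  by rewrite ef fh.
exact: leq_trans le'.
Qed.

Fact tower_ele_comparable k (e f : tower_edge k) :
  (tower_ele e f \/ tower_ele f e) <-> tower_rng e = tower_rng f.
Proof.
split=> [[/andP[/eqP//]|/andP[/eqP/esym//]]|ef].
by have [le|/ltnW le] := leqP (val e).2 (val f).2; [left|right];
  rewrite /tower_ele le andbT; apply/eqP.
Qed.

Definition tower_diagram : ordered_bratteli :=
  @OrderedBratteli (fun k => 'I_(ntowers (sval (P k)))) tower_edge
    tower_src tower_rng tower_ele
    tower_vert_gt0 tower_edge_gt0 tower_vert0 tower_src_surj tower_rng_surj
    tower_ele_refl tower_ele_anti tower_ele_trans tower_ele_comparable.

Fact tower_path_subproof x :
  @infinite_paths tower_diagram (fun k => edge_through k x).
Proof.
by move=> k; rewrite /= -[LHS]/(tower_rng _) -[RHS]/(tower_src _)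
  rng_edge_through src_edge_through.
Qed.

Definition tower_path (x : X) : path_space tower_diagram :=
  SigSub (mem_set (tower_path_subproof x)).

(** The edges give the towers and the increments [lv k.+1 x - lv k x]; with [lv 0 x = 0] all
    positions are recovered. *)
Lemma tower_path_inj : injective tower_path.
Proof.
move=> x y xy; apply: loc_separate.
have exy k : edge_through k x = edge_through k y.
  by rewrite -[LHS]/(path_edge (tower_path x) k) xy.
have lvxy k : lv k x = lv k y.
  elim: k => [|k IH]; first by rewrite !lv0.
  have E : (lv k.+1 x - lv k x = lv k.+1 y - lv k y)%N by rewrite -!edge_through2 exy.
  by rewrite -(subnK (lv_le k x)) -(subnK (lv_le k y)) E IH.
case=> [|k]; apply: injective_projections; try exact: (lvxy _); first exact: tw0.
by rewrite -[LHS]/(tw k.+1 x) -edge_through1 exy edge_through1.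
Qed.

Lemma tower_path_surj (q : path_space tower_diagram) : exists x, tower_path x = q.
Proof.
pose e k : tower_edge k := path_edge q k.
have eP k : tower_src (e k.+1) = (val (e k)).1 by have := set_valP q k.
(* [L k] is the height in [P k] forced by the path, the sum of the heights of its first [k]
   edges. *)
pose L := fix L k := if k is j.+1 then (L j + (val (e j)).2)%N else 0%N.
pose F k := [set x | loc_of (P k) x = (tower_src (e k), L k)].
have F0 : F 0%N !=set0.
  have [x _] := tower_edge_ex (e 0%N); exists x; apply: injective_projections.
    exact: tw0.
  exact: lv0.
(* Let [w] be the start of the passage [e k]. As [F k] is nonempty, [L k] is below the height of its
   tower, so T^(L k) w is still in this passage and lies in [F k.+1]; its position in [P k] is the
   one prescribed by [F k]. *)
have Fstep k : F k !=set0 -> F k.+1 !=set0 /\ F k.+1 `<=` F k.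
  move=> [x xF]; have [w we wb] := tower_edge_ex (e k).
  have w0 : lv k w = 0%N by exact/baseE.
  have Lk : (L k < height (tw k w))%N.
    by rewrite -(tower_srcE we); have := loc_index (svalP (P k)) x;
       rewrite -[loc _ x]/(loc_of (P k) x) xF.
  have wL t : (t <= L k)%N -> loc_of (P k) (iter t T w) = (tw k w, t).
    move=> tL; rewrite /loc_of loc_iter -?[(loc _ w).2]/(lv k w) w0 ?add0n//.
    exact: leq_ltn_trans Lk.
  have yF : F k.+1 (iter (L k) T w).
    rewrite /F /= /loc_of loc_iter_next -?[loc _ w]/(loc_of (P k.+1) w).
      by rewrite we eP addnC.
    move=> t t0 tL /base_decr/baseE; rewrite /lv wL//= => tE.
    by rewrite tE in t0.
  split=> [|y yF']; first by exists (iter (L k) T w).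
  rewrite /F/= (@loc_refine k y (iter (L k) T w)) ?wL ?(tower_srcE we)//.
  by rewrite yF' yF.
have Fne k : F k !=set0 by elim: k => // k /Fstep[].
have [||x xF] := compact_nested X_compact _ Fne.
- by move=> k; exact: (clopen_loc (svalP (P k)) _).2.
- by move=> k; case: (Fstep k (Fne k)).
have locx k : loc_of (P k) x = (tower_src (e k), L k) := xF k.
exists x; apply: path_edge_inj => k.
suff -> : path_edge q k = edge_through k x by [].
apply: tower_edge_eq.
  by rewrite edge_through1 /tw locx -[LHS]eP.
by rewrite edge_through2 /lv !locx /= addKn.
Qed.

Lemma tower_path_continuous : continuous tower_path.
Proof.
apply: continuous_path_space => k e.
have loc_edge x y : loc_of (P k.+1) x = loc_of (P k.+1) y ->
    edge_through k x = edge_through k y.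
  move=> xy; apply: tower_edge_eq; first by rewrite !edge_through1 /tw xy.
  by rewrite !edge_through2 /lv xy (loc_refine xy).
rewrite [X in open X](_ : _ = \bigcup_(x in [set x | edge_through k x = e])
    [set y | loc_of (P k.+1) y = loc_of (P k.+1) x]).
  by apply: bigcup_open => x _; exact: (clopen_loc (svalP (P k.+1)) _).1.
by apply/seteqP; split=> [x xe|x [y ye /= /loc_edge xy]]; [exists x|exact: etrans ye].
Qed.

Lemma tower_path_homeomorphism : homeomorphism tower_path.
Proof.
have [psi psiK] := choice tower_path_surj.
apply: (compact_hausdorff_homeomorphism X_compact (@path_space_hausdorff _)
  tower_path_continuous (g := psi)) => // x.
exact: tower_path_inj.
Qed.

Lemma tower_min_edge k (e : tower_edge k) :
  @min_edge tower_diagram k e <-> (val e).2 = 0%N :> nat.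
Proof.
split=> [emin|e0 f /andP[/eqP fe]]; last first.
  by rewrite e0 leqn0 => /eqP f0; apply: tower_edge_eq; rewrite // e0.
have [y [ye yb]] := tw_ex (val e).1.
have y2 : (val (edge_through k y)).2 = 0%N :> nat.
  by rewrite edge_through2 (iffLR (baseE k.+1 y) yb).
rewrite -(emin (edge_through k y))//.
by rewrite /tower_diagram/= /tower_ele edge_through1 ye eqxx y2.
Qed.

Lemma tower_min_path x : min_path (tower_path x) <-> forall k, base_at k x.
Proof.
split=> [xmin k|xb k]; last first.
  by apply/tower_min_edge; rewrite edge_through2 (iffLR (baseE k.+1 x) (xb k.+1)).
apply/baseE; elim: k => [|k IH]; first exact: lv0.
by have /tower_min_edge := xmin k; rewrite edge_through2 IH subn0.
Qed.

(** No passage begins strictly between the start of the current one and [x]: descending from [x] to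
    the height of [f] gives a base point of [P k] inside the current passage, hence its start. *)
Lemma tower_edge_gap k (f : tower_edge k) x : (val f).1 = tw k.+1 x ->
  (lv k.+1 x - lv k x <= (val f).2)%N -> ((val f).2 <= lv k.+1 x)%N ->
  f = edge_through k x.
Proof.
move=> f1 lef fle; pose s := (lv k.+1 x - (val f).2)%N.
have sk : (s <= lv k x)%N by rewrite leq_subCl.
have /tower_edge_base/baseE : loc_of (P k.+1) (iter s g x) = ((val f).1, (val f).2 : nat).
  by rewrite /loc_of (loc_back TK) ?leq_subr// f1 subKn.
rewrite /lv /loc_of (loc_back TK)//= => /eqP; rewrite subn_eq0 => ks.
apply: tower_edge_eq; rewrite ?edge_through1// edge_through2.
have <- : s = lv k x by apply/eqP; rewrite eqn_leq sk.
by rewrite subKn.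
Qed.

Lemma edge_through_next k x : base_at k (T x) -> ~ base_at k.+1 (T x) ->
  (val (edge_through k (T x))).1 = (val (edge_through k x)).1 /\
  (val (edge_through k (T x))).2 = (lv k.+1 x).+1 :> nat.
Proof.
move=> /baseE Tk Tk1.
have E : loc_of (P k.+1) (T x) = (tw k.+1 x, (lv k.+1 x).+1) by exact: loc_next.
by rewrite !edge_through1 edge_through2 Tk subn0 /tw /lv E.
Qed.

(** [T x] begins a new passage within the same tower of [P k.+1], and by [tower_edge_gap] no passage
    begins in between. *)
Lemma tower_succ_edge k x : base_at k (T x) -> ~ base_at k.+1 (T x) ->
  @succ_edge tower_diagram k (edge_through k x) (edge_through k (T x)).
Proof.
move=> Tk Tk1; have [E1 E2] := edge_through_next Tk Tk1.
have lt : ((val (edge_through k x)).2 < (val (edge_through k (T x))).2)%N.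
  by rewrite E2 edge_through2 ltnS leq_subr.
split.
- by apply/andP; split; [rewrite E1|exact: ltnW].
- by move=> E; move: lt; rewrite E ltnn.
move=> f /andP[/eqP f1 lef] /andP[/eqP f1' fle].
move: fle; rewrite leq_eqVlt => /predU1P[fE|]; first by right; exact: tower_edge_eq.
rewrite E2 ltnS => fle; left; apply: tower_edge_gap => //.
  by rewrite -f1 edge_through1.
by rewrite -edge_through2.
Qed.

(** If [T x] is in the base of [P k.+1], then [x] is at the top of its tower, so no later passage
    begins there; otherwise [T x] begins one. *)
Lemma tower_max_edge k x : base_at k (T x) ->
  (@max_edge tower_diagram k (edge_through k x) <-> base_at k.+1 (T x)).
Proof.
move=> Tk; split=> [xmax|Tk1 f /andP[/eqP f1 lef]].
  apply: contrapT => Tk1; have [le nE _] := tower_succ_edge Tk Tk1.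
  by apply: nE; exact: xmax.
have top : (lv k.+1 x).+1 = height (tw k.+1 x) := top_loc (svalP (P k.+1)) Tk1.
apply: tower_edge_gap; rewrite -?f1 ?edge_through1 -?edge_through2//.
rewrite -ltnS top -(edge_through1 k x) f1.
have [w we _] := tower_edge_ex f; have := loc_index (svalP (P k.+1)) w.
by rewrite -[loc _ w]/(loc_of (P k.+1) w) we.
Qed.

Lemma tower_max_path x : max_path (tower_path x) <-> forall k, base_at k (T x).
Proof.
split=> [xmax k|xb k]; last exact/(tower_max_edge (xb k)).
elim: k => [|k IH]; first by rewrite /base_at P0_base.
by apply/(tower_max_edge IH); exact: xmax.
Qed.

Lemma tower_diagram_simple : essentially_simple tower_diagram.
Proof.
have [|||z zb] := @compact_nested X base_at X_compact.
- by move=> k; exact: (base_clopen (svalP (P k))).2.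
- by move=> k; exact: (base_ex (svalP (P k))).
- exact: base_decr.
split.
  exists (tower_path (g z)); split; first by apply/tower_max_path; rewrite gK.
  move=> q; have [x <-] := tower_path_surj q => /tower_max_path xb.
  by rewrite (base_point zb xb) TK.
exists (tower_path z); split; first exact/tower_min_path.
move=> q; have [x <-] := tower_path_surj q => /tower_min_path xb.
by rewrite (base_point zb xb).
Qed.

Lemma tower_vershik_graph x : vershik_graph (tower_path x) (tower_path (T x)).
Proof.
have [xb|/existsNP[l lN]] := pselect (forall k, base_at k (T x)).
  by left; split; [exact/tower_max_path|exact/tower_min_path].
have exN : exists k, `[< ~ base_at k (T x) >] by exists l; exact/asboolP.
(* [k.+1] is the least level whose base misses [T x]; it is positive because the base of [P 0] is
   [X]. Edge [k] is then the one replaced by its successor. *)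
case: (ex_minnP exN) => -[|k] /asboolP kN kmin.
  by case: kN; rewrite /base_at P0_base.
have xb i : (i <= k)%N -> base_at i (T x).
  move=> ik; apply: contrapT => iN; have := kmin i (asboolT iN).
  by rewrite leqNgt ltnS ik.
right; exists k; split.
- by move=> i ik; apply/(tower_max_edge (xb i (ltnW ik))); exact: xb.
- by move=> /(tower_max_edge (xb k (leqnn k))).
- exact: tower_succ_edge (xb k (leqnn k)) kN.
- move=> i ik; apply/tower_min_edge; rewrite edge_through2.
  by rewrite (iffLR (baseE i.+1 _) (xb i.+1 ik)).
(* Above edge [k] the heights of levels [i] and [i.+1] both grow by one, so their difference is
   unchanged. *)
- move=> i ki; have locT j : (k < j)%N -> loc_of (P j) (T x) = (tw j x, (lv j x).+1).
    by move=> kj; apply: loc_next => /(base_le kj).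
  apply: tower_edge_eq; first by rewrite !edge_through1 /tw locT// ltnW.
  by rewrite !edge_through2 /lv !locT ?subSS// ltnW.
Qed.

Lemma tower_diagram_conjugate : conjugate T (@vershik tower_diagram).
Proof.
exists tower_path; first exact: tower_path_homeomorphism.
apply/funext => x /=.
have [y [_ yU]] := vershik_graph_unique_exists (tower_path x) tower_diagram_simple.
rewrite -(yU _ (tower_vershik_graph x)); apply: yU.
exact: vershikP tower_diagram_simple.
Qed.

End TowerDiagram.

(** * The equivalence of the three conditions *)

Lemma refine_rank_bound (R : realType) (X : metricType R) (T : X -> X) (n : nat) :
  X -> cantor_like X -> (forall x y : X, mdist x y <= 1) -> homeomorphism T ->
  (forall (Z : set X) (Q : set (set X)),
    clopen Z -> finite_covering T Z -> clopen_finite_partition Q ->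
    exists P : towers X,
      [/\ kakutani_rohlin T P /\ (ntowers P <= n)%N,
          base P `<=` Z,
          diam (base P) <= diam Z / 2 &
          refines (elements T P) Q]) ->
  rank_bound T n.
Proof.
move=> x0 [_ cX _ zX] le1 [Tc [g [gc TK gK]]] refine.
have [U [cU UE]] := clopen_enumeration x0 cX.
have [P [nP0 bP0 fP]] := refining_sequence TK gK refine x0 cU.
have base_decr k : base (sval (P k.+1)) `<=` base (sval (P k)) by case: (fP k).
have loc_refine k x y : loc_of (P k.+1) x = loc_of (P k.+1) y ->
    loc_of (P k) x = loc_of (P k) y.
  by have [_ _ _ H] := fP k; move=> /H[].
have loc_separate x y : (forall k, loc_of (P k) x = loc_of (P k) y) -> x = y.
  move=> xy; apply: contrapT => /eqP/zX[V [/UE[k <-] Ux Uy]].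
  have [_ _ _ H] := fP k.
  by have [_ [/(_ Ux)]] := H _ _ (xy k.+1).
have diamP k : diam (base (sval (P k))) <= 2 ^- k.
  elim: k => [|k IH]; first by rewrite expr0 invr1; apply: diam_le.
  have [_ _ le _] := fP k; apply: le_trans le _.
  by rewrite exprSr invfM ler_wpM2r// invr_ge0.
have base_point x y : (forall k, base (sval (P k)) x) ->
    (forall k, base (sval (P k)) y) -> x = y.
  move=> xb yb; apply: contrapT => /eqP; rewrite -mdist_gt0 => d0.
  (* Archimedean choice of [k]: [2 ^+ k] exceeds the inverse of the distance, so the base of [P k]
     is too small to contain both points. *)
  have := upper_nthrootP (leqnn (Num.bound (mdist x y)^-1)).
  set k := Num.bound _ => lt.
  have := le_trans (mdist_le_diam le1 (xb k) (yb k)) (diamP k).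
  rewrite leNgt => /negP; apply.
  by rewrite -[ltRHS]invrK ltf_pV2 ?posrE ?invr_gt0 ?exprn_gt0.
exists (tower_diagram TK nP0 base_decr loc_refine).
split; [exact: tower_diagram_simple| |exact: tower_diagram_conjugate].
by move=> [//|k] _; rewrite card_ord; case: (fP k).
Qed.

(** Well-ordering: once some bound exists, there is a least one. *)
Lemma rank_bound_topological_rank_le (X : topologicalType) (T : X -> X) (n : nat) :
  rank_bound T n -> topological_rank_le T n.
Proof.
move=> Tn; have ex : exists d, `[< rank_bound T d >] by exists n; exact/asboolP.
case: (ex_minnP ex) => d /asboolP Td dmin; exists d; last exact/dmin/asboolP.
by split=> // d' Td'; exact/dmin/asboolP.
Qed.

Lemma topological_rank_le_bound (X : topologicalType) (T : X -> X) (n : nat) :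
  topological_rank_le T n -> rank_bound T n.
Proof.
move=> [d [[B [Bs Bd BT]] _] dn]; exists B; split=> // m m0.
exact: leq_trans (Bd m m0) dn.
Qed.

Theorem theorem3p3 (R : realType) (X : metricType R) (T : X -> X) (n : nat)
  (X_cantor : cantor_like X)
  (X_complete : forall F : set_system X, ProperFilter F -> cauchy F -> exists x : X, F --> x)
  (mdist_le1 : forall x y : X, mdist x y <= 1)
  (T_homeo : homeomorphism T)
  (T_ess_minimal : essentially_minimal T)
  (n_ge1 : (1 <= n)%N) :
  [<-> topological_rank_le T n;
       exists x : X, forall eps : R, 0 < eps ->
         exists P : towers X,
           [/\ kakutani_rohlin T P /\ (ntowers P <= n)%N,
               forall A : set X, elements T P A -> diam A < eps,
               diam (base P) < eps &
               base P x];
       forall (Z : set X) (Q : set (set X)),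
         clopen Z -> finite_covering T Z -> clopen_finite_partition Q ->
         exists P : towers X,
           [/\ kakutani_rohlin T P /\ (ntowers P <= n)%N,
               base P `<=` Z,
               diam (base P) <= diam Z / 2 &
               refines (elements T P) Q]].
Proof.
have [pX cX _ _] := X_cantor.
(* The minimal set is nonempty and supplies a point of [X]. *)
have [_ [[[[x0 _] _ _] _] _]] := T_ess_minimal.
do 2?split.
- by move=> /topological_rank_le_bound; exact: rank_bound_small_towers.
- exact: small_towers_refine.
- by move=> H; exact/rank_bound_topological_rank_le/refine_rank_bound.
Qed.
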